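(* Let $(F,v)$ be a valued field which is complete with respect to a discrete rank 1 valuation $v$. Suppose $\operatorname{char} F=\operatorname{char}\bar F$. Let $D$ be a tame division algebra with $Z(D)=F$ and $[D:F]<\infty$. Then there exists a section $\bar D\hookrightarrow D$ of the residue homomorphism $D\to\bar D$, i.e. a ring homomorphism $s:\bar D\to V_D\subset D$ whose composition with the residue map $V_D\to\bar D$ is the identity of $\bar D$.
   Context: The valuation $v$ extends uniquely to a valuation $w$ on $D$. Write $\Gamma_D$ for its value group, $V_D$ for its valuation ring, $M_D$ for its maximal ideal and $\bar D=V_D/M_D$ for its residue division ring; $\Gamma_F$, $\bar F$ are the corresponding objects for $F$. $D$ is called defectless over $F$ if $[D:F]=|\Gamma_D:\Gamma_F|\cdot[\bar D:\bar F]$. The basic homomorphism $\theta_D:\Gamma_D/\Gamma_F\to \mathrm{Gal}(Z(\bar D)/\bar F)$ is the one induced by conjugation: $w(d)+\Gamma_F$ is sent to the automorphism $\bar a\mapsto\overline{dad^{-1}}$ of $Z(\bar D)$. $D$ is called tame if $\operatorname{char}\bar F=0$, or if $\operatorname{char}\bar F=q\neq0$, $D$ is defectless over $F$, $Z(\bar D)$ is separable over $\bar F$, and $q\nmid|\ker\theta_D|$. *)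

(* Defs.v *)
From HB Require Import structures.
From mathcomp Require Import all_boot all_order all_algebra all_field.
From mathcomp Require Import ring_quotient.
From mathcomp Require Import boolp classical_sets functions cardinality.

Set Implicit Arguments.
Unset Strict Implicit.
Unset Printing Implicit Defensive.

Import Order.TTheory GRing.Theory.
Local Open Scope classical_set_scope.
Local Open Scope card_scope.
Local Open Scope quotient_scope.
Local Open Scope ring_scope.

(** [Num.POrderedZmodule] does not relate the order to the addition; this is the
    structure of totally ordered abelian group. *)

HB.mixin Record POrderedZmodule_isOrdered G of Num.POrderedZmodule G := {
  oz_total : forall x y : G, (x <= y) || (y <= x);
  oz_leD2r_subproof : forall z x y : G, x <= y -> x + z <= y + z
}.

#[short(type="orderedZmodType")]
HB.structure Definition OrderedZmodule :=
  {G of POrderedZmodule_isOrdered G & Num.POrderedZmodule G}.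

Fact int_leD2r (z x y : int) : x <= y -> x + z <= y + z.
Proof. by rewrite Num.Theory.lerD2r. Qed.
HB.instance Definition _ :=
  POrderedZmodule_isOrdered.Build int (@le_total _ int) int_leD2r.

Fact rat_leD2r (z x y : rat) : x <= y -> x + z <= y + z.
Proof. by rewrite Num.Theory.lerD2r. Qed.
HB.instance Definition _ :=
  POrderedZmodule_isOrdered.Build rat (@le_total _ rat) rat_leD2r.

Section OrderedZmoduleTheory.
Variable G : orderedZmodType.
Implicit Types x y z : G.

Lemma oz_leD2r z x y : (x + z <= y + z) = (x <= y).
Proof.
apply/idP/idP; last exact: oz_leD2r_subproof.
by move=> /(oz_leD2r_subproof (- z)); rewrite !addrK.
Qed.

Lemma oz_addr_ge0 x y : 0 <= x -> 0 <= y -> 0 <= x + y.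
Proof. by move=> x0 y0; apply: le_trans y0 _; rewrite -{1}[y]add0r oz_leD2r. Qed.

Lemma oz_addr_gt0l x y : 0 < x -> 0 <= y -> 0 < x + y.
Proof.
rewrite !lt_neqAle => /andP[x0 xge0] yge0; rewrite oz_addr_ge0 // andbT.
apply: contraNneq x0 => xy0; rewrite eq_le xge0 /= -(oz_leD2r y) add0r -xy0.
exact: yge0.
Qed.

Lemma oz_double_eq0 x : x + x = 0 -> x = 0.
Proof.
move=> xx0; apply/eqP; rewrite eq_le; have /orP[h|h] := oz_total 0 x.
  by rewrite h andbT -(oz_leD2r x) xx0 add0r.
by rewrite h /= -(oz_leD2r x) xx0 add0r.
Qed.

End OrderedZmoduleTheory.

(** A valuation is only meaningful on nonzero elements: the value [w 0] is
    arbitrary (instead of being [+oo]), so every condition on values is guarded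
    by [x == 0] or [x != 0].  The definition is meant for division rings. *)

Record valuation (R : nzRingType) (G : orderedZmodType) := Valuation {
  val_fun :> R -> G;
  valuationM : forall x y, x != 0 -> y != 0 ->
    val_fun (x * y) = val_fun x + val_fun y;
  valuationD : forall x y, x != 0 -> y != 0 -> x + y != 0 ->
    Order.min (val_fun x) (val_fun y) <= val_fun (x + y)
}.

Definition val_ge (R : nzRingType) (G : orderedZmodType) (w : valuation R G)
  (g : G) : {pred R} := [pred x | (x == 0) || (g <= w x)].

Definition val_gt (R : nzRingType) (G : orderedZmodType) (w : valuation R G)
  (g : G) : {pred R} := [pred x | (x == 0) || (g < w x)].

Section ValuationTheory.
Variables (R : nzRingType) (G : orderedZmodType) (w : valuation R G).
Implicit Types x y : R.

Lemma valuation1 : w 1 = 0.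
Proof.
by apply: (addrI (w 1)); rewrite addr0 -valuationM ?oner_neq0 // mulr1.
Qed.

Lemma valuationN1 : w (- 1) = 0.
Proof.
apply: oz_double_eq0.
by rewrite -valuationM ?oppr_eq0 ?oner_neq0 // mulrNN mulr1 valuation1.
Qed.

Lemma valuationN x : x != 0 -> w (- x) = w x.
Proof.
move=> x0; rewrite -mulN1r valuationM ?oppr_eq0 ?oner_neq0 //.
by rewrite valuationN1 add0r.
Qed.

Lemma val_ge_zmod_closed g : zmod_closed (val_ge w g).
Proof.
split=> [|x y]; first by rewrite inE eqxx.
rewrite !inE; have [->|x0 /= xge] := eqVneq x 0.
  rewrite add0r oppr_eq0 => _; case: eqVneq => //= y0; first by rewrite valuationN.
have [->|y0 /= yge] := eqVneq y 0; first by rewrite subr0 xge orbT.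
case: eqVneq => //= xy0; apply: le_trans (valuationD _ _ _ xy0) => //.
  by rewrite /Order.min valuationN //; case: ifP.
by rewrite oppr_eq0.
Qed.

Lemma val_gt_zmod_closed g : zmod_closed (val_gt w g).
Proof.
split=> [|x y]; first by rewrite inE eqxx.
rewrite !inE; have [->|x0 /= xge] := eqVneq x 0.
  rewrite add0r oppr_eq0 => _; case: eqVneq => //= y0; first by rewrite valuationN.
have [->|y0 /= yge] := eqVneq y 0; first by rewrite subr0 xge orbT.
case: eqVneq => //= xy0; apply: lt_le_trans (valuationD _ _ _ xy0) => //.
  by rewrite /Order.min valuationN //; case: ifP.
by rewrite oppr_eq0.
Qed.

Lemma val_ge0_subring_closed : subring_closed (val_ge w 0).
Proof.
have [_ sub_closed] := val_ge_zmod_closed 0.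
split=> // [|x y]; first by rewrite inE valuation1 lexx orbT.
rewrite !inE; have [->|x0 /= xge] := eqVneq x 0; first by rewrite mul0r eqxx.
have [->|y0 /= yge] := eqVneq y 0; first by rewrite mulr0 eqxx.
by rewrite valuationM // oz_addr_ge0 ?orbT.
Qed.

Lemma val_gt0_mull x y : x \in val_ge w 0 -> y \in val_gt w 0 ->
  x * y \in val_gt w 0.
Proof.
rewrite !inE; have [->|x0 /= xge] := eqVneq x 0; first by rewrite mul0r eqxx.
have [->|y0 /= ygt] := eqVneq y 0; first by rewrite mulr0 eqxx.
by rewrite valuationM // addrC oz_addr_gt0l ?orbT.
Qed.

Lemma val_gt0_mulr x y : x \in val_gt w 0 -> y \in val_ge w 0 ->
  x * y \in val_gt w 0.
Proof.
rewrite !inE; have [->|x0 /= xge] := eqVneq x 0; first by rewrite mul0r eqxx.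
have [->|y0 /= ygt] := eqVneq y 0; first by rewrite mulr0 eqxx.
by rewrite valuationM // oz_addr_gt0l ?orbT.
Qed.

HB.instance Definition _ :=
  GRing.isSubringClosed.Build R (val_ge w 0) val_ge0_subring_closed.

Definition val_ring : Type := {x : R | x \in val_ge w 0}.
HB.instance Definition _ := [isSub of val_ring for sval].
HB.instance Definition _ := [Choice of val_ring by <:].
HB.instance Definition _ :=
  GRing.SubChoice_isSubNzRing.Build R (val_ge w 0) val_ring
    val_ge0_subring_closed.

(** [Quotient] provides ring structures only over commutative rings, so only
    its additive quotient is reused for [V / M]. *)

Definition val_ideal : {pred val_ring} := [pred x | val x \in val_gt w 0].

Fact val_ideal_zmod_closed : zmod_closed val_ideal.
Proof.
have [z0 zB] := val_gt_zmod_closed 0.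
have E (x : val_ring) : (x \in val_ideal) = (val x \in val_gt w 0) by [].
split=> [|x y]; rewrite !E ?rmorph0 // => xM yM.
by rewrite rmorphB; apply: zB.
Qed.
HB.instance Definition _ :=
  GRing.isZmodClosed.Build val_ring val_ideal val_ideal_zmod_closed.

Definition residue_ring : Type := Quotient.quot val_ideal.
HB.instance Definition _ := EqQuotient.on residue_ring.
HB.instance Definition _ := Choice.on residue_ring.
HB.instance Definition _ := GRing.Zmodule.on residue_ring.

Definition residue : val_ring -> residue_ring := \pi_residue_ring.

Lemma residue_eq (x y : val_ring) :
  (residue x == residue y) = (val (x - y) \in val_gt w 0).
Proof. by rewrite /residue piE. Qed.

Lemma reprK_residue (x : residue_ring) : residue (repr x) = x.
Proof. exact: reprK. Qed.

Definition residue_one : residue_ring := residue 1.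
Definition residue_mul (x y : residue_ring) : residue_ring :=
  residue (repr x * repr y).

Lemma residue_mulE (x y : val_ring) :
  residue (x * y) = residue_mul (residue x) (residue y).
Proof.
rewrite /residue_mul; apply/eqP; rewrite residue_eq.
have h z : val (z - repr (residue z)) \in val_gt w 0.
  by rewrite -residue_eq reprK_residue.
set x' := repr _; set y' := repr _.
have -> : x * y - x' * y' = (x - x') * y + x' * (y - y').
  by rewrite mulrBl mulrBr addrA addrNK.
rewrite -[_ + _]opprK opprD rmorphN rmorphB rmorphN !rmorphM.
have [z0 zB] := val_gt_zmod_closed 0.
have zN z : z \in val_gt w 0 -> - z \in val_gt w 0.
  by move=> zM; rewrite -sub0r; apply: zB.
apply/zN/zB; first by apply/zN/val_gt0_mulr; [exact: h | exact: valP].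
by apply/val_gt0_mull; [exact: valP | exact: h].
Qed.

Fact residue_mulA : associative residue_mul.
Proof.
move=> x y z; rewrite -[x]reprK_residue -[y]reprK_residue -[z]reprK_residue.
by rewrite -!residue_mulE mulrA.
Qed.

Fact residue_mul1 : left_id residue_one residue_mul.
Proof. by move=> x; rewrite -[x]reprK_residue -residue_mulE mul1r. Qed.

Fact residue_mulr1 : right_id residue_one residue_mul.
Proof. by move=> x; rewrite -[x]reprK_residue -residue_mulE mulr1. Qed.

Lemma residue_addE (x y : val_ring) : residue (x + y) = residue x + residue y.
Proof. exact: (raddfD \pi_(Quotient.quot val_ideal)). Qed.

Fact residue_mulDl : left_distributive residue_mul +%R.
Proof.
move=> x y z; rewrite -[x]reprK_residue -[y]reprK_residue -[z]reprK_residue.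
by rewrite -residue_addE -!residue_mulE -residue_addE mulrDl.
Qed.

Fact residue_mulDr : right_distributive residue_mul +%R.
Proof.
move=> x y z; rewrite -[x]reprK_residue -[y]reprK_residue -[z]reprK_residue.
by rewrite -residue_addE -!residue_mulE -residue_addE mulrDr.
Qed.

Lemma residue0 : residue 0 = 0.
Proof. exact: (raddf0 \pi_(Quotient.quot val_ideal)). Qed.

Lemma residue_eq0 (x : val_ring) : (residue x == 0) = (val x \in val_gt w 0).
Proof. by rewrite -residue0 residue_eq subr0. Qed.

Fact residue_one_neq0 : residue_one != 0.
Proof. by rewrite residue_eq0 rmorph1 inE oner_eq0 valuation1 ltxx. Qed.

HB.instance Definition _ := GRing.Zmodule_isNzRing.Build residue_ring
  residue_mulA residue_mul1 residue_mulr1 residue_mulDl residue_mulDr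
  residue_one_neq0.

Fact residue_zmod_morphism : zmod_morphism residue.
Proof. exact: (raddfB \pi_(Quotient.quot val_ideal)). Qed.
HB.instance Definition _ :=
  GRing.isZmodMorphism.Build val_ring residue_ring residue
    residue_zmod_morphism.

Fact residue_monoid_morphism : monoid_morphism residue.
Proof. by split=> // x y; rewrite residue_mulE. Qed.
HB.instance Definition _ :=
  GRing.isMonoidMorphism.Build val_ring residue_ring residue
    residue_monoid_morphism.

(** A representative in [V] of a residue class, and the class of an element of
    [R], with junk value 0 outside [V]. *)

Definition res_lift (x : residue_ring) : R := val (repr x : val_ring).
Definition res_class (x : R) : residue_ring :=
  if insub x is Some u then residue u else 0.

Lemma res_liftP (x : residue_ring) : res_lift x \in val_ge w 0.
Proof. exact: valP. Qed.

Lemma res_class_val (x : val_ring) : res_class (val x) = residue x.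
Proof. by rewrite /res_class valK. Qed.

Lemma res_liftK : cancel res_lift res_class.
Proof. by move=> x; rewrite res_class_val reprK_residue. Qed.

Lemma res_class_eq (x y : R) : x \in val_ge w 0 -> y \in val_ge w 0 ->
  (res_class x == res_class y) = (x - y \in val_gt w 0).
Proof.
move=> xV yV; pose x' : val_ring := Sub x xV; pose y' : val_ring := Sub y yV.
by rewrite -[x]/(val x') -[y]/(val y') -rmorphB !res_class_val residue_eq.
Qed.

Lemma res_classM (x y : R) : x \in val_ge w 0 -> y \in val_ge w 0 ->
  res_class (x * y) = res_class x * res_class y.
Proof.
move=> xV yV; pose x' : val_ring := Sub x xV; pose y' : val_ring := Sub y yV.
by rewrite -[x]/(val x') -[y]/(val y') -rmorphM !res_class_val rmorphM.
Qed.

End ValuationTheory.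

Arguments residue {R G} w _.
Arguments res_class {R G} w _.

Section DivisionRing.
Variables (R : unitRingType) (G : orderedZmodType) (w : valuation R G).
Hypothesis divR : GRing.field_axiom R.
Implicit Types x y : R.

Lemma valuationV x : x != 0 -> w x^-1 = - w x.
Proof.
move=> x0; have xU := divR x0.
have xV0 : x^-1 != 0 by apply: contraTneq xU => h; rewrite -unitrV h unitr0.
by apply/eqP; rewrite -addr_eq0 -valuationM // mulVr // valuation1.
Qed.

Lemma residue_neq0P (x : residue_ring w) : x != 0 ->
  [/\ res_lift x != 0, w (res_lift x) = 0
    & (res_lift x)^-1 \in val_ge w 0].
Proof.
move=> x0; have := x0; rewrite -[x in x != 0]res_liftK res_class_val residue_eq0.
rewrite -/(res_lift x) inE negb_or => /andP[l0 lgt]; have := res_liftP x.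
rewrite inE (negPf l0) /= => lge.
have wl0 : w (res_lift x) = 0.
  by apply/eqP; move: lgt; rewrite lt_neqAle lge andbT negbK eq_sym.
by split=> //; rewrite inE valuationV // wl0 oppr0 lexx orbT.
Qed.

Lemma residue_mulVx (x : residue_ring w) : x != 0 ->
  res_class w (res_lift x)^-1 * x = 1.
Proof.
move=> x0; have [l0 _ lV] := residue_neq0P x0.
rewrite -[x in _ * x]res_liftK -res_classM ?res_liftP // mulVr ?divR //.
exact: (res_class_val (1 : val_ring w)).
Qed.

Lemma residue_mulxV (x : residue_ring w) : x != 0 ->
  x * res_class w (res_lift x)^-1 = 1.
Proof.
move=> x0; have [l0 _ lV] := residue_neq0P x0.
rewrite -[x in x * _]res_liftK -res_classM ?res_liftP // mulrV ?divR //.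
exact: (res_class_val (1 : val_ring w)).
Qed.

End DivisionRing.

Section ResidueField.
Variables (F : fieldType) (G : orderedZmodType) (v : valuation F G).

Fact residue_mulC : commutative (@GRing.mul (residue_ring v)).
Proof.
by move=> x y; rewrite -[x]res_liftK -[y]res_liftK -!res_classM ?res_liftP // mulrC.
Qed.
HB.instance Definition _ :=
  GRing.PzSemiRing_hasCommutativeMul.Build (residue_ring v) residue_mulC.

Definition residue_inv (x : residue_ring v) : residue_ring v :=
  if x == 0 then 0 else res_class v (res_lift x)^-1.

Fact residue_mulVf (x : residue_ring v) : x != 0 -> residue_inv x * x = 1.
Proof.
by move=> x0; rewrite /residue_inv (negPf x0) residue_mulVx //; apply: fieldP.
Qed.

Fact residue_inv0 : residue_inv 0 = 0. Proof. by rewrite /residue_inv eqxx. Qed.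

HB.instance Definition _ :=
  GRing.ComNzRing_isField.Build (residue_ring v) residue_mulVf residue_inv0.

End ResidueField.

Definition value_group (R : nzRingType) (G : orderedZmodType)
  (w : valuation R G) : set G := w @` [set x | x != 0].

Definition add_coset (G : zmodType) (H : set G) (g : G) : set G :=
  [set g + h | h in H].

Definition coset_space (G : zmodType) (A H : set G) : set (set G) :=
  add_coset H @` A.

Section ValuedField.
Variables (F : fieldType) (G : orderedZmodType) (v : valuation F G).

Definition discrete_rank1 : Prop :=
  exists2 g : G, 0 < g & value_group v = [set g *~ n | n in [set: int]].

(** Closeness is measured with values of elements of [F] only, because the
    ambient group [G] may have elements larger than all of [value_group v]. *)
Definition val_cauchy (u : nat -> F) : Prop :=
  forall c, c != 0 -> exists N, forall m n, (N <= m)%N -> (N <= n)%N ->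
    u m - u n \in val_gt v (v c).

Definition val_converges (u : nat -> F) (l : F) : Prop :=
  forall c, c != 0 -> exists N, forall n, (N <= n)%N ->
    u n - l \in val_gt v (v c).

Definition val_complete : Prop :=
  forall u, val_cauchy u -> exists l, val_converges u l.

End ValuedField.

Section ValuedDivisionAlgebra.
Variables (F : fieldType) (G : orderedZmodType) (v : valuation F G).
Variables (D : falgType F) (w : valuation D G).

Definition val_extends : Prop := forall a : F, a != 0 -> w a%:A = v a.

Local Notation "'Fbar'" := (residue_ring v).
Local Notation "'Dbar'" := (residue_ring w).

(** The embedding of residue rings induced by [F -> D], when [w] extends [v]. *)
Definition res_embed (x : Fbar) : Dbar := res_class w (res_lift x)%:A.

(** The family [b] is a basis of [Dbar] as a left [Fbar]-vector space. *)
Definition residue_degree (f : nat) : Prop :=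
  exists b : 'I_f -> Dbar, forall x : Dbar,
    exists! c : {ffun 'I_f -> Fbar}, x = \sum_i res_embed (c i) * b i.

Definition ramification_index (e : nat) : Prop :=
  coset_space (value_group w) (value_group v) #= `I_e.

Definition defectless : Prop :=
  exists e f, [/\ ramification_index e, residue_degree f
                & \dim {:D} = (e * f)%N].

Definition residue_center : set Dbar := [set z | forall x, GRing.comm z x].

Definition residue_center_separable : Prop :=
  forall z, residue_center z ->
    exists2 p : {poly Fbar}, separable_poly p & root (map_poly res_embed p) z.

Definition res_conj (d : D) (x : Dbar) : Dbar :=
  res_class w (d * res_lift x * d^-1).

(** The basic homomorphism, as a map from cosets of [value_group v] to maps
    [Dbar -> Dbar], of which only the restriction to [residue_center] is
    meaningful; [basic_homE] shows the independence of the chosen [d]. *)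
Definition basic_hom (C : set G) : Dbar -> Dbar :=
  res_conj
    (xget 1 [set d : D | d != 0 /\ add_coset (value_group v) (w d) = C]).

Definition basic_hom_ker : set (set G) :=
  [set C | coset_space (value_group w) (value_group v) C /\
           forall z, residue_center z -> basic_hom C z = z].

Definition tame : Prop :=
  [pchar Fbar] =i pred0 \/
  exists2 q, q \in [pchar Fbar] &
    [/\ defectless, residue_center_separable
      & exists2 k, basic_hom_ker #= `I_k & ~~ (q %| k)%N].

Hypothesis divD : GRing.field_axiom D.
Hypothesis ext : val_extends.

Lemma res_embedE (a : F) : a \in val_ge v 0 ->
  res_embed (res_class v a) = res_class w a%:A.
Proof.
have inV (b : F) : b \in val_ge v 0 -> b%:A \in val_ge w 0.
  rewrite !inE; have [->|b0 /= bge] := eqVneq b 0; first by rewrite scale0r eqxx.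
  by rewrite ext // bge orbT.
move=> aV; apply/eqP; rewrite res_class_eq ?inV ?res_liftP // -scalerBl.
have : res_lift (res_class v a) - a \in val_gt v 0.
  by rewrite -res_class_eq ?res_liftP // res_liftK.
set b := _ - _; rewrite !inE; have [->|b0 /= bgt] := eqVneq b 0.
  by rewrite scale0r eqxx.
by rewrite ext // bgt orbT.
Qed.

Lemma conj_val_ge (d x : D) : d != 0 -> x \in val_ge w 0 ->
  d * x * d^-1 \in val_ge w 0.
Proof.
move=> d0; rewrite !inE; have [->|x0 /= xge] := eqVneq x 0.
  by rewrite mulr0 mul0r eqxx.
have dU := divD d0; have xU := divD x0.
have nz y : y \is a GRing.unit -> y != 0 :> D.
  by apply: contraTneq => ->; rewrite unitr0.
have dx0 : d * x != 0 by rewrite nz // unitrMr.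
have dV0 : d^-1 != 0 by rewrite nz // unitrV.
rewrite !valuationM // valuationV //.
by rewrite addrAC subrr add0r xge orbT.
Qed.

Lemma conj_val_gt (d x : D) : d != 0 -> x \in val_gt w 0 ->
  d * x * d^-1 \in val_gt w 0.
Proof.
move=> d0; rewrite !inE; have [->|x0 /= xge] := eqVneq x 0.
  by rewrite mulr0 mul0r eqxx.
have dU := divD d0; have xU := divD x0.
have nz y : y \is a GRing.unit -> y != 0 :> D.
  by apply: contraTneq => ->; rewrite unitr0.
have dx0 : d * x != 0 by rewrite nz // unitrMr.
have dV0 : d^-1 != 0 by rewrite nz // unitrV.
rewrite !valuationM // valuationV //.
by rewrite addrAC subrr add0r xge orbT.
Qed.

Lemma res_conjE (d x : D) : d != 0 -> x \in val_ge w 0 ->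
  res_conj d (res_class w x) = res_class w (d * x * d^-1).
Proof.
move=> d0 xV; apply/eqP; rewrite /res_conj res_class_eq ?conj_val_ge ?res_liftP //.
rewrite -mulrBl -mulrBr conj_val_gt //.
by rewrite -res_class_eq ?res_liftP // res_liftK.
Qed.

Lemma res_conj_center (d d' : D) (z : Dbar) : d != 0 -> d' != 0 ->
  add_coset (value_group v) (w d) = add_coset (value_group v) (w d') ->
  residue_center z -> res_conj d z = res_conj d' z.
Proof.
move=> d0 d'0 eqC zZ.
have nz (y : D) : y \is a GRing.unit -> y != 0.
  by apply: contraTneq => ->; rewrite unitr0.
have dU := divD d0; have d'U := divD d'0.
have : add_coset (value_group v) (w d) (w d).
  exists 0; last by rewrite addr0.
  by exists 1 => /=; [exact: oner_neq0 | exact: valuation1].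
rewrite eqC => -[_ [a /= a0 <-]] wd.
have aA0 : a%:A != 0 :> D by rewrite scaler_eq0 negb_or a0 oner_neq0.
have aU := divD aA0.
pose u := a%:A^-1 * (d'^-1 * d).
have uU : u \is a GRing.unit by rewrite !unitrMr ?unitrV.
have auU : a%:A * u \is a GRing.unit by rewrite unitrMr.
have u0 := nz _ uU.
have dE : d = d' * (a%:A * u) by rewrite /u !mulVKr.
clearbody u.
have wu : w u = 0.
  apply: (addrI (w d' + v a)); rewrite addr0 [RHS]wd [in RHS]dE.
  by rewrite valuationM ?nz // valuationM // ext // addrA.
have uV : u \in val_ge w 0 by rewrite inE wu lexx orbT.
have uVV : u^-1 \in val_ge w 0 by rewrite inE valuationV // wu oppr0 lexx orbT.
have conj_u : res_conj u z = z.
  have [_ _ vM] := val_ge0_subring_closed w.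
  rewrite /res_conj !res_classM ?res_liftP ?vM ?res_liftP //.
  rewrite res_liftK -(zZ (res_class w u)) -mulrA -res_classM // divrr //.
  by rewrite (res_class_val (1 : val_ring w)) rmorph1 mulr1.
rewrite -[in RHS]conj_u [res_conj u z]/(res_class _ _).
rewrite res_conjE ?conj_val_ge ?res_liftP //.
congr (res_class w _); rewrite {1 2}dE !invrM //.
have aK (y : D) : a%:A * y / a%:A = y by rewrite mulr_algl -mulr_algr mulrK.
by rewrite -[in RHS](aK (u * _ / u)) !mulrA.
Qed.

Lemma basic_homE (d : D) (z : Dbar) : d != 0 -> residue_center z ->
  basic_hom (add_coset (value_group v) (w d)) z = res_conj d z.
Proof.
move=> d0 zZ; rewrite /basic_hom; case: xgetP => [d' -> [d'0 eqC]|no].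
  exact: res_conj_center.
by case: (no d).
Qed.

End ValuedDivisionAlgebra.

(* Main.v *)
(** Write [V], [I] for the valuation ring of [F] and its maximal ideal.  Since
    [char F = char Fbar], [V] contains a field [k] mapping isomorphically onto
    [Fbar] (Cohen); it is obtained as the intersection of a decreasing sequence
    of subrings [L_n] such that [L_n / I^n] is a coefficient field of [V / I^n],
    each step being an application of Zorn's lemma.

    The residue ring [Dbar] is then a finite-dimensional division algebra over
    [k] whose center is separable over [k] (automatically in characteristic 0, by
    tameness otherwise), so it has a separability idempotent.  As in the
    Wedderburn-Malcev theorem, the idempotent kills the Hochschild 2-cocycles
    which obstruct correcting a [k]-linear section [Dbar -> V_D] into one which
    is multiplicative modulo higher and higher powers of the maximal ideal, and
    the limit of the corrected sections exists because [D] is complete. *)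

Require Import Defs.
From HB Require Import structures.
From mathcomp Require Import all_boot all_order all_algebra all_field.
From mathcomp Require Import boolp classical_sets.
From mathcomp Require Import ring.

Set Implicit Arguments.
Unset Strict Implicit.
Unset Printing Implicit Defensive.

Import Order.TTheory GRing.Theory.
Local Open Scope ring_scope.

(** * Layers of a discrete valuation *)

(** The values of [w] need not be multiples of the generator [g] of the value group of [v]. With [d]
    the dimension of [D], only [d!] times [w] is shown to take such values; [D] is therefore
    filtered by the values of this multiple, which has the same valuation ring and maximal ideal as
    [w]. The price is a shift of indices: layer [n] of [F] lands in layer [d! * n] of [D].

    No vector space structure is put on the residue algebra. Dimension arguments use maximal
    independent families, whose length is bounded by [d] because independent families lift to [D].

    The idempotent is built in two stages joined by transitivity: generators of the center are
    adjoined one at a time as separable roots, and the passage from the center to the whole division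
    ring uses operators made of left and right multiplications.

    A correction leaves an error quadratic in the previous one. Only one further layer is claimed
    each time, which is enough for convergence. *)

Section OrderedZmoduleMultiples.
Variable G : orderedZmodType.
Implicit Types a b c d g : G.

Lemma oz_leD a b c d : a <= b -> c <= d -> a + c <= b + d.
Proof.
move=> ab cd; apply: (le_trans (y := b + c)); first by rewrite oz_leD2r.
by rewrite ![b + _]addrC oz_leD2r.
Qed.

Lemma oz_leNgt a b : (a <= b) = ~~ (b < a).
Proof.
apply/idP/idP => [ab|]; first by apply: contraTN ab => /lt_geF ->.
by have /orP[//|ba] := oz_total a b; rewrite lt_neqAle ba andbT negbK => /eqP ->.
Qed.

Lemma oz_ltNge a b : (a < b) = ~~ (b <= a).
Proof. by rewrite oz_leNgt negbK. Qed.

Lemma oz_leMn n a b : a <= b -> a *+ n <= b *+ n.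
Proof. by move=> ab; elim: n => // n IHn; rewrite !mulrS oz_leD. Qed.

Lemma oz_lt0Mn n a : (0 < n)%N -> 0 < a -> 0 < a *+ n.
Proof.
case: n => // n _ a0; rewrite mulrS oz_addr_gt0l //.
by rewrite -(mul0rn _ n) oz_leMn // ltW.
Qed.

Lemma oz_subr_ge0 a b : (0 <= b - a) = (a <= b).
Proof. by rewrite -(oz_leD2r a 0) add0r subrK. Qed.

Lemma oz_le_lt_add a b c : a <= b -> 0 < c -> a < b + c.
Proof.
move=> ab c0; have : 0 < c + (b - a) by rewrite oz_addr_gt0l ?oz_subr_ge0.
rewrite addrA [c + b]addrC; apply: contraTT; rewrite -!oz_leNgt => h.
by rewrite -(oz_leD2r a) subrK add0r.
Qed.

Lemma oz_leMn_cancel n a b : (0 < n)%N -> a *+ n <= b *+ n -> a <= b.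
Proof.
move=> n0; rewrite !oz_leNgt; apply: contraNN => ba.
have h : 0 < a - b.
  by rewrite lt_neqAle oz_subr_ge0 (ltW ba) andbT eq_sym subr_eq0 gt_eqF.
have := oz_le_lt_add (lexx (b *+ n)) (oz_lt0Mn n0 h).
by rewrite mulrnBl addrC subrK.
Qed.

Lemma oz_leMnl g m n : 0 <= g -> (m <= n)%N -> g *+ m <= g *+ n.
Proof.
move=> g0 /subnK <-; rewrite mulrnDr -{1}[g *+ m]add0r oz_leD2r.
by rewrite -(mul0rn _ (n - m)) oz_leMn.
Qed.

Lemma oz_mulrz_ge g (z : int) (n : nat) :
  0 < g -> (g *+ n <= g *~ z) = (n%:Z <= z).
Proof.
move=> g0; have g0' := ltW g0; apply/idP/idP.
  apply: contraTT; rewrite -ltNge -oz_ltNge => zn.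
  have -> : g *+ n = g *~ z + g *+ `|n%:Z - z|%N.
    rewrite -[g *+ `|_|]/(g *~ `|_|%N).
    rewrite gez0_abs ?Num.Theory.subr_ge0 ?(ltW zn) //.
    by rewrite -mulrzDr [z + _]addrC subrK.

  by rewrite oz_le_lt_add // oz_lt0Mn // absz_gt0 subr_eq0 gt_eqF.
by case: z => // z; exact: oz_leMnl.
Qed.

End OrderedZmoduleMultiples.

Section Layers.
Variables (R : nzRingType) (G : orderedZmodType) (w : valuation R G) (g : G).

(** For [v], with [g] the positive generator of its value group, this is the [n]-th power of the
    maximal ideal. *)
Definition layer (n : nat) : {pred R} := val_ge w (g *+ n).

Fact layer_zmod_closed n : zmod_closed (layer n).
Proof. exact: val_ge_zmod_closed. Qed.
HB.instance Definition _ n :=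
  GRing.isZmodClosed.Build R (layer n) (layer_zmod_closed n).

Lemma layerE n x : (x \in layer n) = (x == 0) || (g *+ n <= w x).
Proof. by []. Qed.

Lemma layerM m n x y : x \in layer m -> y \in layer n -> x * y \in layer (m + n).
Proof.
rewrite !layerE; have [->|x0 /= xm] := eqVneq x 0; first by rewrite mul0r eqxx.
have [->|y0 /= yn] := eqVneq y 0; first by rewrite mulr0 eqxx.
by rewrite valuationM // mulrnDr oz_leD ?orbT.
Qed.

Lemma layer_mull n x y : x \in layer 0 -> y \in layer n -> x * y \in layer n.
Proof. exact: layerM. Qed.

Lemma layer_mulr n x y : x \in layer n -> y \in layer 0 -> x * y \in layer n.
Proof. by move=> xn y0; rewrite -[n]addn0 layerM. Qed.

Lemma layer_1 : 1 \in layer 0.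
Proof. by rewrite layerE valuation1 lexx orbT. Qed.

Hypothesis g_gt0 : 0 < g.

Lemma layer_le m n x : (m <= n)%N -> x \in layer n -> x \in layer m.
Proof.
rewrite !layerE => mn; case: eqVneq => //= _.
by apply: le_trans; rewrite oz_leMnl // ltW.
Qed.

Lemma layerX m k x : x \in layer m -> x ^+ k \in layer (k * m).
Proof.
move=> xm; elim: k => [|k IHk]; first by rewrite expr0 mul0n layer_1.
by rewrite exprS mulSn layerM.
Qed.

Lemma layer0X k x : x \in layer 0 -> x ^+ k \in layer 0.
Proof. by move=> /(layerX k); rewrite muln0. Qed.

(** By the ultrametric inequality, steps that all lie in layer [n] add up to an element of layer
    [n]; control of consecutive differences is therefore enough. *)
Lemma layer_cauchy (u : nat -> R) : (forall n, u n.+1 - u n \in layer n) ->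
  forall m n, (n <= m)%N -> u m - u n \in layer n.
Proof.
move=> uJ m n /subnK <-; elim: (m - n)%N => [|k IHk]; first by rewrite subrr rpred0.
rewrite addSn -(subrKA (u (k + n)%N)) rpredD //.
by apply: layer_le (uJ _) => //; apply: leq_addl.
Qed.

Hypothesis w_int : forall x, x != 0 -> exists z : int, w x = g *~ z.

(** Values are integer multiples of [g], so none lies strictly between [0] and [g]. *)
Lemma layer1E x : (x \in layer 1) = (x \in val_gt w 0).
Proof.
rewrite layerE inE; have [//|x0 /=] := eqVneq x 0; have [z ->] := w_int x0.
rewrite oz_mulrz_ge //; case: z => [[|n]|n]; first by rewrite ltxx.
  by rewrite (oz_lt0Mn (ltn0Sn n) g_gt0).
symmetry; apply/negbTE; rewrite -oz_leNgt -(oz_leD2r (g *+ n.+1)) add0r.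
by rewrite NegzE mulrNz addNr ltW // oz_lt0Mn.
Qed.

Lemma layer_bigcap x : (forall n, x \in layer n) -> x = 0.
Proof.
move=> h; apply/eqP/negP => /negP x0; have [z wz] := w_int x0.
have := h `|z|.+1%N; rewrite layerE (negPf x0) wz oz_mulrz_ge //=.
by apply/negP; rewrite -ltNge; case: z {wz} => // n; rewrite ltz_nat /=.
Qed.

End Layers.

Section LayersUnit.
Variables (R : unitRingType) (G : orderedZmodType) (w : valuation R G) (g : G).
Hypothesis divR : GRing.field_axiom R.

Lemma valuationX k x : x != 0 -> x ^+ k != 0 /\ w (x ^+ k) = w x *+ k.
Proof.
move=> x0; elim: k => [|k [xk0 wk]]; first by rewrite expr0 oner_eq0 valuation1.
have xU := divR x0; split; last by rewrite exprS valuationM // wk mulrS.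
by apply: contraNneq xk0 => h; rewrite -(mulKr xU (x ^+ k)) -exprS h mulr0.
Qed.

Hypothesis g_gt0 : 0 < g.
Hypothesis w_int : forall x, x != 0 -> exists z : int, w x = g *~ z.
Local Notation I := (layer w g).

Lemma layer_unit u : u \in I 0 -> u \notin I 1 -> u != 0 /\ u^-1 \in I 0.
Proof.
rewrite layer1E // inE negb_or => u0 /andP[nz u1]; split=> //.
move: u0; rewrite !layerE (negPf nz) /= valuationV // mulr0n => u0.
move: u1; rewrite -oz_leNgt => u1.
have -> : w u = 0 by apply/eqP; rewrite eq_le u1.
by rewrite oppr0 lexx orbT.
Qed.

Lemma layer_mul_cancel n u x : u \in I 0 -> u \notin I 1 ->
  u * x \in I n -> x \in I n.
Proof.
move=> u0 u1 uxn; have [nz uV] := layer_unit u0 u1.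
by rewrite -(mulKr (divR nz) x) layer_mull.
Qed.

End LayersUnit.

(** * Coefficient fields *)

(** Zorn's lemma and dependent choice deliver bare predicates; packing them restores the structure
    that the [rpred] lemmas need. *)
Lemma subring_bundle (R : nzRingType) (L : {pred R}) :
  subring_closed L -> exists LS : subringClosed R, LS = L :> {pred R}.
Proof.
move=> L_closed.
pose LS : subringClosed R := HB.pack L (GRing.isSubringClosed.Build R L L_closed).
by exists LS.
Qed.

Lemma size_sub_lead (R : nzRingType) (p q : {poly R}) : p != 0 ->
  (size q <= size p)%N -> q`_(size p).-1 = lead_coef p ->
  (size (p - q)%R < size p)%N.
Proof.
move=> p0 qp lc; have sp : (0 < size p)%N by rewrite size_poly_gt0.
rewrite -[X in (_ < X)%N](prednK sp) ltnS; apply/leq_sizeP => j.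
rewrite leq_eqVlt => /orP[/eqP <-|]; first by rewrite coefB lc subrr.
by rewrite (prednK sp) => pj; rewrite coefB !nth_default ?subrr // (leq_trans qp).
Qed.

Lemma subring_closedP (R : nzRingType) (L : subringClosed R) : subring_closed L.
Proof. by split; [exact: rpred1 | exact: rpredB | exact: rpredM]. Qed.

Section CoefficientField.
Variables (F : fieldType) (G : orderedZmodType) (v : valuation F G) (g : G).
Hypothesis g_gt0 : 0 < g.
Hypothesis v_int : forall x, x != 0 -> exists z : int, v x = g *~ z.
(** Equality of the characteristics enters in this form: an integer that vanishes in the residue
    field already vanishes in [F]. *)
Hypothesis natr_residue : forall k, k%:R \in layer v g 1 -> k != 0%N ->
  exists2 p, p \in [pchar F] & (p %| k)%N.
Local Notation I := (layer v g).
Let divF : GRing.field_axiom F := @fieldP F.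

(* If [approximates n L] and [surjects L], then [L / I n] is a coefficient field
   of [V / I n]; handling its preimage [L] avoids quotient rings. *)
Definition surjects (L : {pred F}) :=
  forall x, x \in I 0 -> exists2 y, y \in L & x - y \in I 1.

Definition approximates n (L : {pred F}) :=
  [/\ {subset L <= I 0}, {subset I n <= L}
    & forall x, x \in L -> x \in I 1 -> x \in I n].

Lemma natr_layer0 k : k%:R \in I 0.
Proof. by rewrite rpredMn // layer_1. Qed.

Section Adjoin.
Variables (L : subringClosed F) (y : F).

Definition adjoin : {pred F} :=
  fun x => `[< exists2 Q, Q \is a polyOver L & x = Q.[y] >].

Lemma adjoinP x :
  reflect (exists2 Q, Q \is a polyOver L & x = Q.[y]) (x \in adjoin).
Proof. exact: asboolP. Qed.

Fact adjoin_subring_closed : subring_closed adjoin.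
Proof.
split=> [|_ _ /adjoinP[P PL ->] /adjoinP[Q QL ->]|
  _ _ /adjoinP[P PL ->] /adjoinP[Q QL ->]]; apply/adjoinP.
- by exists 1; rewrite ?rpred1 // hornerE.
- by exists (P - Q); rewrite ?rpredB // !hornerE.
- by exists (P * Q); rewrite ?rpredM // !hornerE.
Qed.
HB.instance Definition _ :=
  GRing.isSubringClosed.Build F adjoin adjoin_subring_closed.

Lemma adjoin_base x : x \in L -> x \in adjoin.
Proof. by move=> xL; apply/adjoinP; exists x%:P; rewrite ?polyOverC ?hornerC. Qed.

Lemma adjoin_gen : y \in adjoin.
Proof. by apply/adjoinP; exists 'X; rewrite ?polyOverX ?hornerX. Qed.

End Adjoin.

Section Step.
Variables (n : nat) (n_gt0 : (0 < n)%N) (L0 : subringClosed F).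
Hypothesis L0_approx : approximates n L0.
Hypothesis L0_surj : surjects L0.

Let L0_I0 x : x \in L0 -> x \in I 0. Proof. by case: L0_approx => h _ _ /h. Qed.
Let L0_In x : x \in I n -> x \in L0. Proof. by case: L0_approx => _ h _ /h. Qed.
Let L0_I1 x : x \in L0 -> x \in I 1 -> x \in I n.
Proof. by case: L0_approx => _ _; apply. Qed.

(* In characteristic [p] the last condition plays the role of a p-basis: it
   makes the residue field purely inseparable of exponent one over the residues
   of [L], so that adjoining a p-th root never meets an obstruction. *)
Definition candidate (L : {pred F}) :=
  [/\ {subset L <= L0}, {subset I n.+1 <= L},
      forall x, x \in L -> x \in I 1 -> x \in I n.+1
    & forall p, p \in [pchar F] -> forall y, y \in L0 -> y ^+ p \in L].

(** The starting ring consists of the [p]-th powers of [L0] in characteristic [p], of the integers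
    in characteristic 0, enlarged by [I n.+1]. A [p]-th power in [I 1] comes from an element of
    [I n], and [p * n] is at least [n.+1]; in characteristic 0 no nonzero integer lies in [I 1]. *)
Lemma candidate0 : exists L : subringClosed F, candidate L.
Proof.
have In1L0 x : x \in I n.+1 -> x \in L0.
  by move=> xI; apply: L0_In; apply: layer_le xI.
have [[p pF]|noF] := pselect (exists p, p \in [pchar F]).
  pose L : {pred F} := fun x => `[< exists2 y, y \in L0 & x - y ^+ p \in I n.+1 >].
  have LP x : reflect (exists2 y, y \in L0 & x - y ^+ p \in I n.+1) (x \in L).
    exact: asboolP.
  have p_pr := pcharf_prime pF.
  have L_closed : subring_closed L.
    split=> [|a b /LP[x xL ax] /LP[y yL bY]|a b /LP[x xL ax] /LP[y yL bY]].
    - by apply/LP; exists 1; rewrite ?rpred1 // expr1n subrr rpred0.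
    - apply/LP; exists (x - y); first exact: rpredB.
      have -> : (x - y) ^+ p = x ^+ p - y ^+ p.
        by rewrite -!(pFrobenius_autE pF) rmorphB.
      have -> : a - b - (x ^+ p - y ^+ p) = (a - x ^+ p) - (b - y ^+ p).
        by rewrite !opprD !opprK addrACA.
      by rewrite rpredB.
    - apply/LP; exists (x * y); first exact: rpredM.
      have -> : a * b - (x * y) ^+ p = (a - x ^+ p) * (b - y ^+ p)
          + (x ^+ p * (b - y ^+ p) + y ^+ p * (a - x ^+ p)).
        by rewrite exprMn; ring.
      have xp : x ^+ p \in I 0 by rewrite layer0X // L0_I0.
      have yp : y ^+ p \in I 0 by rewrite layer0X // L0_I0.
      have h : a - x ^+ p \in I 0 by apply: layer_le ax.
      by rewrite !rpredD // layer_mull.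
  have [LS LSE] := subring_bundle L_closed.
  exists LS; rewrite LSE; split => [x|x xI|x|q qF y yL].
  - move=> /LP[y yL h].
    by rewrite -(subrK (y ^+ p) x) rpredD ?rpredX //; exact: In1L0.
  - apply/LP; exists 0; rewrite ?rpred0 // expr0n.
    by rewrite (gtn_eqF (prime_gt0 p_pr)) subr0.
  - move=> /LP[y yL h] xI; rewrite -(subrK (y ^+ p) x) rpredD //.
    apply: (layer_le g_gt0 (n := (p * n)%N)).
      apply: (@leq_trans (2 * n)); first by rewrite mul2n -addnn -addn1 leq_add2l.
      by rewrite leq_mul2r prime_gt1 ?orbT.
    apply: layerX => //; apply: L0_I1 => //.
    have : y ^+ p \in I 1.
      by rewrite -(subKr x (y ^+ p)) rpredB //; apply: layer_le h.
    apply: contraLR => yI; have y0 := L0_I0 yL.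
    elim: (p) => [|k IHk]; last first.
      by rewrite exprS; apply: contraNN IHk; apply: layer_mul_cancel.
    by rewrite expr0 layer1E // inE oner_eq0 valuation1 ltxx.
  - suff <- : p = q by apply/LP; exists y => //; rewrite subrr rpred0.
    by have := pF; rewrite (pcharf_eq qF) inE => /eqP.
pose L : {pred F} := fun x => `[< exists k : int, x - k%:~R \in I n.+1 >].
have LP x : reflect (exists k : int, x - k%:~R \in I n.+1) (x \in L).
  exact: asboolP.
have zI k : (k : int)%:~R \in I 0.
  by case: k => k; [|rewrite NegzE rmorphN rpredN]; rewrite natr_layer0.
have L_closed : subring_closed L.
  split=> [|a b /LP[x ax] /LP[y bY]|a b /LP[x ax] /LP[y bY]]; apply/LP.
  - by exists 1; rewrite subrr rpred0.
  - exists (x - y); rewrite rmorphB opprD opprK addrACA.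
    by rewrite -[- b + _]opprK opprD opprK rpredB.
  - exists (x * y).
    have -> : a * b - (x * y)%:~R = (a - x%:~R) * (b - y%:~R)
        + (x%:~R * (b - y%:~R) + y%:~R * (a - x%:~R)).
      by rewrite rmorphM /=; ring.
    have h : a - x%:~R \in I 0 by apply: layer_le ax.
    by rewrite !rpredD // layer_mull.
have [LS LSE] := subring_bundle L_closed.
exists LS; rewrite LSE; split => [x|x xI|x|q qF]; last by case: noF; exists q.
- move=> /LP[k h].
  by rewrite -(subrK k%:~R x) rpredD ?rpred_int //; exact: In1L0.
- by apply/LP; exists 0; rewrite subr0.
- move=> /LP[k h] xI; suff k0 : k = 0 by move: h; rewrite k0 subr0.
  have : `|k|%N%:R \in I 1.
    have : k%:~R \in I 1.
      by rewrite -(subKr x k%:~R) rpredB //; apply: layer_le h.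
    by case: k {h} => k; rewrite // NegzE rmorphN rpredN.
  move=> kI; apply/eqP; rewrite -absz_eq0; apply/negPn/negP => k0.
  by have [p pF _] := natr_residue kI k0; case: noF; exists p.
Qed.

Lemma candidate_max : exists2 L : subringClosed F, candidate L
  & forall L' : subringClosed F, candidate L' ->
      {subset L <= L'} -> {subset L' <= L}.
Proof.
have [B0 B0c] := candidate0.
pose T := {L : F -> bool | subring_closed L /\ candidate L}.
have B0T := conj (subring_closedP B0) B0c.
pose tB0 : T := exist _ (B0 : {pred F}) B0T.
pose R : rel T := fun L L' => 
  `[< forall x, x \in sval L -> x \in sval L' >].
have RP (L L' : T) :
    reflect (forall x, x \in sval L -> x \in sval L') (R L L').
  exact: asboolP.
have [||A totA|[L [L_closed Lc]] maxL] := @ZL_preorder T tB0 R.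
- by move=> L; apply/RP.
- by move=> L1 L2 L3 /RP h1 /RP h2; apply/RP => x /h1 /h2.
(* The empty chain needs its own bound, since the union of no rings is empty. *)
- have [[t0 At0]|noA] := pselect (exists t, A t); last first.
    by exists tB0 => s As; case: noA; exists s.
  pose U : {pred F} := fun x => `[< exists2 t : T, A t & x \in sval t >].
  have UP x : reflect (exists2 t : T, A t & x \in sval t) (x \in U).
    exact: asboolP.
  have U2 x y : x \in U -> y \in U ->
      exists t : T, [/\ A t, x \in sval t & y \in sval t].
    move=> /UP[t At xt] /UP[t' At' yt'].
    have [/RP h|/RP h] := totA t t' At At'.
      by exists t'; split=> //; apply: h.
    by exists t; split=> //; apply: h.
  have U_closed : subring_closed U.
    split=> [|x y /U2 h /h[t [At xt yt]]|x y /U2 h /h[t [At xt yt]]]; apply/UP.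
    - by exists t0; case: (svalP t0) => -[].
    - by exists t; case: (svalP t) => -[_ tB _ _] //; apply: tB.
    - by exists t; case: (svalP t) => -[_ _ tM _] //; apply: tM.
  have Uc : candidate U.
    split => [x /UP[t At xt]|x xI|x /UP[t At xt] xI|p pF y yL].
    - by have [_ [h _ _ _]] := svalP t; apply: h.
    - by apply/UP; exists t0 => //; have [_ [_ h _ _]] := svalP t0; apply: h.
    - by have [_ [_ _ h _]] := svalP t; apply: h.
    - by apply/UP; exists t0 => //; have [_ [_ _ _ h]] := svalP t0; apply: h.
  exists (exist _ U (conj U_closed Uc)) => t At; apply/RP => x xt.
  by apply/UP; exists t.
- have [LS LSE] := subring_bundle L_closed.
  exists LS; rewrite LSE // => L' L'c LL'.
  have L'T := conj (subring_closedP L') L'c.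
  pose tL' : T := exist _ (L' : {pred F}) L'T.
  apply/(RP tL' (exist _ L (conj L_closed Lc))).
  by apply: maxL; apply/RP.
Qed.

(** A maximal candidate [L] represents every residue. If no polynomial over [L] with unit leading
    coefficient annihilates the residue of [x], then [x] can be adjoined like a transcendental.
    Otherwise, some [y] congruent to [x] is a root modulo [I n.+1] of a polynomial of at most the
    least annihilating degree, and [y] can be adjoined. *)
Lemma refine_approximation : exists L : subringClosed F,
  [/\ {subset L <= L0}, approximates n.+1 L & surjects L].
Proof.
have [L Lc maxL] := candidate_max; exists L; case: (Lc) => LL0 InL LI1 powL.
have L_I0 x : x \in L -> x \in I 0 by move=> /LL0/L0_I0.
split=> //.
(* Adjoining [y] keeps the candidate property, so [y] is in [L] already. *)
have adjoin_in y : y \in L0 ->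
    (forall Q, Q \is a polyOver L -> Q.[y] \in I 1 -> Q.[y] \in I n.+1) ->
    y \in L.
  move=> yL0 yQ; apply: (maxL (adjoin L y)); last exact: adjoin_gen.
    split=> [_ /adjoinP[Q QL ->]|x xI|_ /adjoinP[Q QL ->]|p pF z zL].
    - apply: rpred_horner => //; apply: polyOverS QL; exact: LL0.
    - by apply: adjoin_base; apply: InL.
    - exact: yQ.
    - by apply: adjoin_base; apply: powL.
  by move=> x; apply: adjoin_base.
move=> z zI0; have [x xL0 zx] := L0_surj zI0.
suff [y yL xy] : exists2 y, y \in L & x - y \in I 1.
  by exists y => //; rewrite -(subrKA x) rpredD.
pose annihilates P :=
  [/\ P \is a polyOver L, lead_coef P \notin I 1 & P.[x] \in I 1].
(* The leading coefficient of a relation shorter than every annihilator lies in [L] and in [I 1],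
   hence in [I n.+1]; removing that term and repeating treats all coefficients. *)
have small d : (forall P, annihilates P -> (d <= size P)%N) ->
    forall Q, Q \is a polyOver L -> (size Q < d)%N -> Q.[x] \in I 1 ->
    Q \is a polyOver (I n.+1).
  move=> dmin Q; have [k] := ubnP (size Q); elim: k Q => // k IHk Q.
  rewrite ltnS => Qk QL Qd Qx; have [->|Q0] := eqVneq Q 0; first exact: rpred0.
  have lcL : lead_coef Q \in L by apply: (polyOverP QL).
  have lcI : lead_coef Q \in I 1.
    by apply: contraLR Qd => lcI; rewrite -leqNgt dmin.
  pose M := lead_coef Q *: 'X^((size Q).-1).
  have ML : M \is a polyOver L by rewrite polyOverZ // rpredX ?polyOverX.
  have MI : M \is a polyOver (I n.+1).
    apply/polyOverP => i; rewrite coefZ coefXn mulr_natr rpredMn //.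
    exact: LI1.
  have lt : (size (Q - M)%R < size Q)%N.
    apply: size_sub_lead => //; last by rewrite coefZ coefXn eqxx mulr1.
    rewrite (leq_trans (size_scale_leq _ _)) //.
    by rewrite size_polyXn prednK ?size_poly_gt0.
  rewrite -(subrK M Q); apply: rpredD => //; apply: IHk.
  - exact: leq_trans lt _.
  - by rewrite rpredB.
  - exact: ltn_trans lt Qd.
  - by rewrite hornerD hornerN rpredB // !hornerE layer_mulr // layer0X // L0_I0.
have over_horner Q y :
    y \in L0 -> Q \is a polyOver (I n.+1) -> Q.[y] \in I n.+1.
  move=> /L0_I0 y0 /polyOverP QI.
  by rewrite horner_coef rpred_sum // => i _; rewrite layer_mulr // layer0X.
have horner_cong y Q : y \in L0 -> x - y \in I 1 -> Q \is a polyOver L ->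
    Q.[x] - Q.[y] \in I 1.
  move=> yL xy /polyOverP QL; rewrite !horner_coef -sumrB rpred_sum // => i _.
  rewrite -mulrBr layer_mull ?L_I0 // subrXX layer_mulr // rpred_sum // => j _.
  by rewrite L0_I0 // rpredM ?rpredX.
have [exP|noP] :=
  pselect (exists d, `[< exists2 P, annihilates P & size P = d >]); last first.
  exists x; last by rewrite subrr rpred0.
  apply: adjoin_in => // Q QL Qx; apply: over_horner => //.
  apply: (small (size Q).+1) => // P Pa.
  by case: noP; exists (size P); apply/asboolP; exists P.
case: (ex_minnP exP) => d /asboolP[P Pa dP] dmin {exP}.
have {}dmin Q : annihilates Q -> (d <= size Q)%N.
  by move=> Qa; apply: dmin; apply/asboolP; exists Q.
(* Division by [Q] leaves a remainder shorter than [d], to which [small] applies. Inverses may be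
   missing from [L], so [S] is multiplied by [lead_coef Q] and this unit is cancelled in [F]. *)
have key Q y : Q \is a polyOver L -> lead_coef Q \notin I 1 -> (size Q <= d)%N ->
    y \in L0 -> x - y \in I 1 -> Q.[y] \in I n.+1 -> y \in L.
  move=> QL lcQ Qd yL xy Qy; apply: adjoin_in => // S.
  have [k] := ubnP (size S); elim: k S => // k IHk S; rewrite ltnS => Sk SL Sy.
  have [Sd|dS] := ltnP (size S) d.
    apply: over_horner => //; apply: (small d dmin S SL Sd).
    by have := rpredD (horner_cong y S yL xy SL) Sy; rewrite subrK.
  have lcQL : lead_coef Q \in L by apply: (polyOverP QL).
  have lcQ0 : lead_coef Q != 0 by apply: contraNneq lcQ => ->; rewrite rpred0.
  apply: (layer_mul_cancel divF g_gt0 v_int (L_I0 _ lcQL) lcQ).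
  have [->|S0] := eqVneq S 0; first by rewrite horner0 mulr0 rpred0.
  pose M := (lead_coef S *: 'X^(size S - size Q)) * Q.
  have M_L : lead_coef S *: 'X^(size S - size Q) \is a polyOver L.
    by rewrite polyOverZ ?rpredX ?polyOverX //; apply: (polyOverP SL).
  have ML : M \is a polyOver L by rewrite rpredM.
  have sM : size M = size S.
    have Q0 : Q != 0 by rewrite -lead_coef_eq0.
    have M0 : lead_coef S *: 'X^(size S - size Q) != 0.
      by rewrite scaler_eq0 negb_or lead_coef_eq0 S0 monic_neq0 ?monicXn.
    rewrite size_mul // size_scale ?lead_coef_eq0 // size_polyXn addSn /= subnK //.
    exact: leq_trans dS.
  have lt : (size (lead_coef Q *: S - M)%R < size S)%N.
    rewrite -[X in (_ < X)%N](size_scale _ lcQ0) size_sub_lead //.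
    - by rewrite scaler_eq0 negb_or lcQ0.
    - by rewrite size_scale // sM.
    - rewrite size_scale // -sM -/(lead_coef M) lead_coefM !lead_coefZ lead_coefXn.
      by rewrite mulr1 mulrC.
  have MI : M.[y] \in I n.+1.
    rewrite hornerM layer_mull // L0_I0 // rpred_horner //.
    by apply: polyOverS M_L.
  rewrite -hornerZ -(subrK M (_ *: S)) hornerD rpredD // IHk //.
  - exact: leq_trans lt _.
  - by rewrite rpredB ?polyOverZ.
  - rewrite hornerD hornerN rpredB ?hornerZ ?layer_mull ?L_I0 //.
    by apply: layer_le MI.
case: Pa => PL lcP Px; have PL0 : P \is a polyOver L0 by apply: polyOverS PL.
have lcL : lead_coef P \in L by apply: (polyOverP PL).
have P0 : P != 0 by apply: contraNneq lcP => ->; rewrite lead_coef0 rpred0.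
have Pxn : P.[x] \in I n by rewrite L0_I1 // rpred_horner.
(* If [P'(x)] is a unit, correct [x] by one step of Newton's method; otherwise
   the characteristic is [p] and [x] itself is a root of [X^p - x^p] over [L]. *)
have [P'x|P'x] := boolP (P^`().[x] \in I 1).
  have d2 : (1 < d)%N.
    rewrite ltnNge; apply: contraNN lcP => d1.
    have := Px; rewrite [P]size1_polyC ?dP // hornerC lead_coefC.
    by [].
  (* The derivative is shorter than [P] and vanishes at [x] modulo [I 1], so its top coefficient,
     [d.-1] times the unit [lead_coef P], is small. Hence [p] divides the degree [d.-1], and
     [X^p - x^p] is short enough for [key]. *)
  have P'I : P^`() \is a polyOver (I n.+1).
    apply: (small d) => //; first exact: polyOver_deriv.
    by rewrite -dP lt_size_deriv.
  have dI : d.-1%:R \in I 1.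
    apply: (layer_mul_cancel divF g_gt0 v_int (L_I0 _ lcL) lcP).
    have [e de] : exists e, d = e.+2 by case: (d) d2 => [|[|e]] // _; exists e.
    rewrite mulr_natr lead_coefE dP de /= -coef_deriv.
    by apply: (layer_le g_gt0 (ltn0Sn n)); apply: (polyOverP P'I).
  have [p pF pd] : exists2 p, p \in [pchar F] & (p %| d.-1)%N.
    by apply: natr_residue => //; rewrite -lt0n -ltnS (ltn_predK d2).
  have p0 := prime_gt0 (pcharf_prime pF).
  exists x; last by rewrite subrr rpred0.
  apply: (key ('X^p - (x ^+ p)%:P)) => //; rewrite ?subrr ?rpred0 //.
  - by rewrite rpredB ?rpredX ?polyOverX // polyOverC powL.
  - rewrite (monicP (monicXnsubC _ p0)) layer1E // inE oner_eq0 valuation1.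
    by rewrite ltxx.
  - rewrite size_XnsubC // -(ltn_predK d2) ltnS dvdn_leq //.
    by rewrite -ltnS (ltn_predK d2).
  - by rewrite !hornerE subrr rpred0.
have P'xL : P^`().[x] \in L0 by rewrite rpred_horner ?polyOver_deriv.
have [P'nz P'V] := layer_unit divF g_gt0 v_int (L0_I0 P'xL) P'x.
pose h := - (P.[x] / P^`().[x]).
have hn : h \in I n by rewrite rpredN layer_mulr.
have hL : h \in L0 by apply: L0_In.
have hI1 : h \in I 1 by apply: layer_le hn.
exists (x + h); last by rewrite opprD addNKr rpredN.
apply: (key P) => //; first by rewrite dP.
- exact: rpredD.
- by rewrite opprD addNKr rpredN.
(* The width [(size P).+2] ensures that two terms can be split off. The others contain [h ^+ 2],
   which lies in [I (n + n)], inside [I n.+1]. *)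
rewrite (@nderiv_taylor_wide _ (size P).+2); [|exact: mulrC|by rewrite !leqW].
rewrite !big_ord_recl nderivn0 nderivn1 expr0 mulr1 expr1 addrA.
have -> : P.[x] + P^`().[x] * h = 0.
  by rewrite mulrN mulrCA mulfV // mulr1 subrr.
rewrite add0r rpred_sum // => i _; rewrite /= !exprS.
rewrite layer_mull //; last first.
  rewrite mulrA layer_mulr ?layer0X ?L0_I0 //.
  by apply: (layer_le g_gt0 _ (layerM hn hn)); rewrite -addn1 leq_add2l.
by rewrite L0_I0 // rpred_horner // polyOver_nderivn.
Qed.

End Step.
End CoefficientField.

(** * Limit of the approximate coefficient fields *)

Section CoefficientFieldLimit.
Variables (F : fieldType) (G : orderedZmodType) (v : valuation F G) (g : G).
Hypothesis g_gt0 : 0 < g.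
Hypothesis v_int : forall x, x != 0 -> exists z : int, v x = g *~ z.
Hypothesis natr_residue : forall k, k%:R \in layer v g 1 -> k != 0%N ->
  exists2 p, p \in [pchar F] & (p %| k)%N.
Hypothesis v_cplt : forall u, (forall n, u n.+1 - u n \in layer v g n) ->
  exists l, forall n, l - u n \in layer v g n.
Local Notation I := (layer v g).

(** Completeness gives surjectivity: representatives [u n] of a residue in [Ln n] differ by elements
    of [Ln n] in [I 1], hence in [I n.+1], so they converge; the limit stays in each [Ln n], which
    contains [I n.+1]. *)
Lemma coefficient_field : exists L : subringClosed F,
  [/\ {subset L <= I 0}, forall x, x \in L -> x \in I 1 -> x = 0
    & surjects v g L].
Proof.
(* Stage [n] has precision [n.+1], so the chain can start with the whole valuation ring, taken
   modulo [I 1]. *)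
pose ok n (L : F -> bool) :=
  [/\ subring_closed (L : {pred F}), approximates v g n.+1 L & surjects v g L].
pose T := {nL : nat * (F -> bool) | ok nL.1 nL.2}.
pose R (s t : T) := (sval t).1 = (sval s).1.+1 /\
  forall x, (sval t).2 x -> (sval s).2 x.
have ok0 : ok 0%N (I 0).
  split; [exact: val_ge0_subring_closed| | ].
    by split=> // x; apply: layer_le.
  by move=> x xI; exists x; rewrite ?subrr ?rpred0.
have step (s : T) : exists t, R s t.
  have [Lc] := svalP s; case: (subring_bundle Lc) => LS LSE.
  rewrite -[(sval s).2]/((sval s).2 : {pred F}) -LSE => La Ls.
  have [L' [LL' L'a L's]] :=
    refine_approximation g_gt0 v_int natr_residue (ltn0Sn _) La Ls.
  have h : ok (sval s).1.+1 (L' : {pred F}) by split=> //; exact: subring_closedP.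
  exists (exist _ ((sval s).1.+1, (L' : {pred F}) : F -> bool) h).
  split=> //= x xL'.
  by have := LL' x xL'; rewrite LSE.
have [f [f0 fR]] := dependent_choice (fun s => cid (step s))
  (exist _ (0%N, (I 0) : F -> bool) ok0).
pose Ln n : {pred F} := (sval (f n)).2.
have Ln_ok n : ok n (Ln n).
  suff {1}<- : (sval (f n)).1 = n by exact: (svalP (f n)).
  by elim: n => [|n IHn]; [rewrite f0 | case: (fR n) => -> _; rewrite IHn].
have Ln_dec n m x : (n <= m)%N -> x \in Ln m -> x \in Ln n.
  move=> /subnK <-; elim: (m - n)%N => // k IHk xL; apply: IHk.
  by case: (fR (k + n)%N) => _; apply.
pose L : {pred F} := fun x => `[< forall n, x \in Ln n >].
have LP x : reflect (forall n, x \in Ln n) (x \in L) by exact: asboolP.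
have L_closed : subring_closed L.
  split=> [|x y /LP xL /LP yL|x y /LP xL /LP yL]; apply/LP => n;
    have [[L1 LB LM] _ _] := Ln_ok n; [exact: L1|exact: LB|exact: LM].
have [LS LSE] := subring_bundle L_closed.
exists LS; rewrite LSE; split=> [x /LP/(_ 0%N)|x /LP xL xI|x xI].
- by have [_ [h _ _] _] := Ln_ok 0%N; apply: h.
- apply: (layer_bigcap g_gt0 v_int) => n; have [_ [_ _ h] _] := Ln_ok n.
  by apply: (layer_le g_gt0 (leqnSn n)); apply: h.
have ex n : exists y, y \in Ln n /\ x - y \in I 1.
  by have [_ _ /(_ x xI)[y yL xy]] := Ln_ok n; exists y.
have [u uP] := choice ex.
have u_step m n : (n <= m)%N -> u m - u n \in I n.+1.
  move=> nm; have [Lc [_ _ h] _] := Ln_ok n; apply: h.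
    have [_ LB _] := Lc; apply: LB; last by case: (uP n).
    by apply: (Ln_dec _ _ _ nm); case: (uP m).
  rewrite -(subrKA x) -[u m - x]opprB [- _ + _]addrC rpredB //.
    by case: (uP n).
  by case: (uP m).
have [l lP] : exists l, forall n, l - u n \in I n.
  by apply: v_cplt => n; by apply: (layer_le g_gt0 (leqnSn n)); apply: u_step.
(* Passing through [u n.+1] gains the exponent that membership in [Ln n] requires. *)
have lS n : l - u n \in I n.+1.
  rewrite -(subrKA (u n.+1)) rpredD //; last exact: u_step.
exists l; last first.
  by rewrite -(subrKA (u 0%N)) -[u 0%N - l]opprB rpredB //; case: (uP 0%N).
apply/LP => n; have [Lc [_ h _] _] := Ln_ok n.
have {h} : l - u n \in Ln n by exact: h.
have : u n \in Ln n by case: (uP n).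
have [LS' <-] := subring_bundle Lc; move=> un lun.
by rewrite -(subrK (u n) l) rpredD.
Qed.

End CoefficientFieldLimit.

(** * Separability idempotents *)

Section Separating.
Variable A : nzRingType.
Implicit Types K L M S : A -> Prop.

Definition central (z : A) := forall x, z * x = x * z.

Definition balanced (W : zmodType) K (B : A -> A -> W) :=
  [/\ forall x x' y, B (x + x') y = B x y + B x' y,
      forall x y y', B x (y + y') = B x y + B x y'
    & forall c, K c -> forall x y, B (x * c) y = B x (c * y)].

(* [r] lists the pure tensors of an element of [A (x)_K A] which multiplies to 1
   and commutes with [L]; balanced maps stand for the maps out of this tensor
   product.  For [L] everything it is a separability idempotent. *)
Definition separating K L := exists r : seq (A * A),
  \sum_(e <- r) e.1 * e.2 = 1 /\
  forall (W : zmodType) (B : A -> A -> W), balanced K B -> forall c, L c ->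
    \sum_(e <- r) B e.1 (e.2 * c) = \sum_(e <- r) B (c * e.1) e.2.

Section Balanced.
Variables (W : zmodType) (K : A -> Prop) (B : A -> A -> W).
Hypothesis balB : balanced K B.

Lemma balanced_suml (I : Type) (s : seq I) (f : I -> A) y :
  B (\sum_(i <- s) f i) y = \sum_(i <- s) B (f i) y.
Proof.
case: balB => BD _ _; apply: (big_morph (B^~ y)) => //.
by apply: (addrI (B 0 y)); rewrite -BD !addr0.
Qed.

Lemma balanced_sumr (I : Type) (s : seq I) (f : I -> A) x :
  B x (\sum_(i <- s) f i) = \sum_(i <- s) B x (f i).
Proof.
case: balB => _ BD _; apply: (big_morph (B x)) => //.
by apply: (addrI (B x 0)); rewrite -BD !addr0.
Qed.

End Balanced.

(** The tensor of [L] over [K] is inserted in the middle of that of [M] over [L]. Because the former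
    commutes with [L], the map [B'] obtained by this insertion is balanced over [L]. *)
Lemma separating_tower K L M :
  separating K L -> separating L M -> separating K M.
Proof.
move=> [r1 [r1_1 r1L]] [r2 [r2_1 r2M]].
exists [seq (x.1 * z.1, z.2 * x.2) | x <- r2, z <- r1]; split.
  rewrite big_allpairs_dep /= -[RHS]r2_1; apply: eq_bigr => x _.
  transitivity (x.1 * (\sum_(z <- r1) z.1 * z.2) * x.2); last by rewrite r1_1 mulr1.
  by rewrite mulr_sumr mulr_suml; apply: eq_bigr => z _; rewrite !mulrA.
move=> W B [BDl BDr BK] c Mc; rewrite !big_allpairs_dep /=.
pose B' x y := \sum_(z <- r1) B (x * z.1) (z.2 * y).
have B'L : balanced L B'.
  split=> [x x' y|x y y'|d Ld x y].
  - by rewrite -big_split; apply: eq_bigr => z _; rewrite mulrDl BDl.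
  - by rewrite -big_split; apply: eq_bigr => z _; rewrite mulrDr BDr.
  - rewrite /B'; under eq_bigr do rewrite -mulrA.
    under [RHS]eq_bigr do rewrite mulrA.
    rewrite -(r1L _ (fun z z' => B (x * z) (z' * y)) _ d Ld) //.
    split=> [z z' t|z t t'|e Ke z t]; first by rewrite mulrDr BDl.
      by rewrite mulrDl BDr.
    by rewrite mulrA BK // mulrA.
transitivity (\sum_(x <- r2) B' (c * x.1) x.2).
  rewrite -(r2M _ _ B'L _ Mc).
  by apply: eq_bigr => x _; apply: eq_bigr => z _; rewrite mulrA.
by apply: eq_bigr => x _; apply: eq_bigr => z _; rewrite mulrA.
Qed.

Lemma separating_base K L : separating K L -> forall S,
  (forall (W : zmodType) (B : A -> A -> W), balanced S B -> balanced K B) ->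
  separating S L.
Proof. by move=> [r [r1 rL]] S SK; exists r; split=> // W B /SK /rL. Qed.

Lemma separating_sub K L M : separating K L -> (forall c, M c -> L c) ->
  separating K M.
Proof. by move=> [r [r1 rL]] ML; exists r; split=> // W B BK c /ML; exact: rL. Qed.

Lemma separating_refl K : separating K K.
Proof.
exists [:: (1, 1)]; split=> [|W B [_ _ BK] c Kc]; rewrite !big_seq1 /=.
  by rewrite mulr1.
by rewrite mul1r mulr1 -{1}(mulr1 c) -BK // mul1r.
Qed.

(* The tensor is the divided difference of [sum_j c_j X^j], evaluated at
   [(alpha, alpha)] and divided by the derivative at [alpha]. *)
Lemma separating_root S (alpha u : A) n (c : nat -> A) :
  (forall s, S s -> central s) -> central alpha -> central u ->
  (forall i, S (c i)) ->
  \sum_(0 <= j < n) c j * alpha ^+ j = 0 ->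
  (\sum_(0 <= j < n) (c j * alpha ^+ j.-1) *+ j) * u = 1 ->
  separating S (fun x => S x \/ x = alpha).
Proof.
move=> Sc alphaC uC cS root0 deriv1.
exists [seq (c j * alpha ^+ i, alpha ^+ (j - i.+1) * u)
  | j <- index_iota 0 n, i <- index_iota 0 j]; split.
  rewrite big_allpairs_dep /= -[RHS]deriv1 mulr_suml; apply: eq_bigr => j _.
  rewrite -[X in _ *+ X]subn0 -sumr_const_nat mulr_suml.
  apply: eq_big_nat => i /andP[_ ij].
  rewrite -!mulrA [alpha ^+ i * _]mulrA -exprD.
  by case: j ij => // j ij; rewrite subSS subnKC.
move=> W B BS d [Sd|->]; have [BDl BDr Bc] := BS.
  rewrite !big_allpairs_dep /=; apply: eq_bigr => j _; apply: eq_bigr => i _.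
  by rewrite -(Sc d Sd (_ * u)) -Bc // (Sc d Sd (c j * _)).
rewrite !big_allpairs_dep /=; apply/eqP; rewrite -subr_eq0 -sumrB; apply/eqP.
(* Multiplying by [alpha] on the right or on the left gives [T j i] or [T j i.+1], so the difference
   telescopes; both end sums contain the relation satisfied by [alpha]. *)
pose T j i := B (c j * alpha ^+ i) (alpha ^+ (j - i) * u).
transitivity (\sum_(0 <= j < n) (T j 0 - T j j)).
  apply: eq_bigr => j _; rewrite -sumrB -opprB -telescope_sumr // -sumrN.
  apply: eq_big_nat => i /andP[_ ij]; rewrite opprB /T; congr (_ - _).
    by rewrite -mulrA -(alphaC u) mulrA -exprSr -subSn // subSS.
  by rewrite alphaC -mulrA -exprSr.
rewrite sumrB /T.
under eq_bigr do rewrite expr0 mulr1 subn0 -[c _]mul1r Bc // mulrA.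
rewrite -(balanced_sumr BS) -mulr_suml root0 mul0r.
under [X in _ - X]eq_bigr do rewrite subnn expr0 mul1r.
rewrite -(balanced_suml BS) root0.
have -> : B 1 0 = 0 by apply: (addrI (B 1 0)); rewrite -BDr !addr0.
have -> : B 0 u = 0 by apply: (addrI (B 0 u)); rewrite -BDl !addr0.
by rewrite subr0.
Qed.

Lemma separating_seq K (s : seq A) : (forall c, K c -> central c) ->
  (forall alpha, alpha \in s -> central alpha /\ exists u n c,
     [/\ central u, forall i, K (c i), \sum_(0 <= j < n) c j * alpha ^+ j = 0
       & (\sum_(0 <= j < n) (c j * alpha ^+ j.-1) *+ j) * u = 1]) ->
  separating K (fun x => K x \/ x \in s).
Proof.
move=> KC; elim: s => [|a s IHs] sP.
  by apply: separating_sub (separating_refl K) _ => c [].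
have {}IHs := IHs (fun x xs => sP x (mem_behead (s := a :: s) xs)).
have [aC [u [n [c [uC cK c0 c1]]]]] := sP a (mem_head a s).
apply: separating_sub (separating_tower IHs
  (separating_root (c := c) _ aC uC _ c0 c1)) _.
- by move=> x [/KC //|xs]; case: (sP x) => //; rewrite inE xs orbT.
- by move=> i; left.
- move=> x [Kx|]; first by left; left.
  by rewrite inE => /orP[/eqP ->|xs]; [right|left; right].
Qed.

End Separating.

(** * Separability of a division ring over its center *)

Section CenterSeparating.
Variable A : nzRingType.
Hypothesis divA : forall x : A, x != 0 -> exists y, y * x = 1 /\ x * y = 1.

(** These operators are the action on [A] of the tensor product of [A] with its opposite ring; the
    list is the tensor. *)
Definition two_sided (T : A -> A) := exists r : seq (A * A),
  forall x, T x = \sum_(e <- r) e.1 * x * e.2.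

Lemma two_sided_id : two_sided id.
Proof. by exists [:: (1, 1)] => x; rewrite big_seq1 mul1r mulr1. Qed.

Lemma two_sidedD T U : two_sided T -> two_sided U ->
  two_sided (fun x => T x + U x).
Proof.
by move=> [r rT] [s sU]; exists (r ++ s) => x; rewrite big_cat rT sU.
Qed.

Lemma two_sidedMl a T : two_sided T -> two_sided (fun x => a * T x).
Proof.
move=> [r rT]; exists [seq (a * e.1, e.2) | e <- r] => x.
by rewrite big_map rT mulr_sumr; apply: eq_bigr => e _; rewrite !mulrA.
Qed.

Lemma two_sidedMr a T : two_sided T -> two_sided (fun x => T x * a).
Proof.
move=> [r rT]; exists [seq (e.1, e.2 * a) | e <- r] => x.
by rewrite big_map rT mulr_suml; apply: eq_bigr => e _; rewrite !mulrA.
Qed.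

Lemma two_sided_sum m (T : 'I_m -> A -> A) : (forall i, two_sided (T i)) ->
  two_sided (fun x => \sum_i T i x).
Proof.
elim: m T => [|m IHm] T TP; first by exists [::] => x; rewrite big_ord0 big_nil.
have [r rT] := two_sidedD (TP ord0) (IHm _ (fun i => TP (lift ord0 i))).
by exists r => x; rewrite big_ord_recl rT.
Qed.

Lemma two_sided_linear T m (c f : 'I_m -> A) : two_sided T ->
  (forall i, central (c i)) -> T (\sum_i c i * f i) = \sum_i c i * T (f i).
Proof.
move=> [r rT] cC; under [RHS]eq_bigr do rewrite rT mulr_sumr.
rewrite exchange_big rT; apply: eq_bigr => e _ /=.
rewrite mulr_sumr mulr_suml; apply: eq_bigr => i _.
by rewrite [e.1 * _]mulrA -(cC i e.1) !mulrA.
Qed.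

(** Two-sided operators are linear over the center, so [T] certifies the independence of [y] over
    it, as a dual basis would. *)
Definition dual_family m (y : 'I_m -> A) (T : 'I_m -> A -> A) :=
  (forall i, two_sided (T i)) /\ forall i j, T i (y j) = (i == j)%:R.

(** The normalized operator [u * U] is dual to [z]; subtracting multiples of it makes the old
    operators vanish at [z]. *)
Lemma dual_family_extend m (y : 'I_m -> A) T z U : dual_family y T ->
  two_sided U -> (forall i, U (y i) = 0) -> U z != 0 ->
  exists y' T', @dual_family m.+1 y' T'.
Proof.
move=> [Top Tdual] Uop U0 Uz; have [u [uUz _]] := divA Uz.
exists (fun i => oapp y z (unlift ord0 i)).
exists (fun i => if unlift ord0 i is Some k
  then fun x => T k x + - T k z * (u * U x) else fun x => u * U x).
split=> [i|i j].
  case: unliftP => [k _|_]; last exact: two_sidedMl.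
  by apply: two_sidedD => //; do 2!apply: two_sidedMl.
case: unliftP => [k|] -> /=.
- case: unliftP => [l|] -> /=; last by rewrite uUz mulr1 subrr.
  by rewrite U0 !mulr0 addr0 Tdual (inj_eq lift_inj).
- by case: unliftP => [l|] -> /=; rewrite ?U0 ?mulr0 ?eq_liftF // uUz eqxx.
Qed.

(* Artin-Whaples: if no two-sided operator separates [z] from the [y i], apply
   this to [x |-> T k x * b] for all [b] to see that [T k z] is central. *)
Lemma dual_family_span m (y : 'I_m -> A) T : dual_family y T ->
  ~ (exists y' T', @dual_family m.+1 y' T') ->
  forall z, (forall i, central (T i z)) /\ z = \sum_i y i * T i z.
Proof.
move=> yT maxm z; have [Top Tdual] := yT.
have span U : two_sided U -> U z = \sum_i U (y i) * T i z.
  move=> Uop; apply/eqP; rewrite -subr_eq0; apply/negPn/negP => Uz0; apply: maxm.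
  apply: (@dual_family_extend m y T z
    (fun x => U x + \sum_i - U (y i) * T i x)) => //.
  - by apply: two_sidedD => //; apply: two_sided_sum => i; apply: two_sidedMl.
  - move=> j; rewrite (bigD1 j) //= Tdual eqxx mulr1.
    rewrite big1 ?addr0 ?subrr // => i ij.
    by rewrite Tdual (negPf ij) mulr0.
  - by apply: contraNneq Uz0; under eq_bigr do rewrite mulNr; rewrite sumrN => ->.
split=> [k b|]; last exact: span two_sided_id.
rewrite (span _ (two_sidedMr b (Top k))) (bigD1 k) //= Tdual eqxx mul1r.
rewrite big1 ?addr0 //.
by move=> i ik; rewrite Tdual eq_sym (negPf ik) !mul0r.
Qed.

(** A maximal dual family is a basis over the center. Some [T k] is nonzero at [1], and dividing it
    by that central value gives an operator with central values that sends [1] to [1]. The list of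
    this operator is the idempotent: its product is the value at [1], and centrality of the values
    makes it commute with [A]. *)
Lemma separating_center n :
  (forall m (y : 'I_m -> A) T, dual_family y T -> (m <= n)%N) ->
  separating (@central A) (fun=> True).
Proof.
move=> bound.
pose P m := `[< exists (y : 'I_m -> A) T, dual_family y T >].
have exP : exists m, P m.
  exists 0%N; apply/asboolP; exists (fun=> 0), (fun=> id).
  by split=> [|i]; [move=> _; exact: two_sided_id | case: i].
have boundP m : P m -> (m <= n)%N by move=> /asboolP[y [T /bound]].
case: (ex_maxnP exP boundP) => m /asboolP[y [T yT]] maxm.
have {maxm} spanT z :
    (forall i, central (T i z)) /\ z = \sum_i y i * T i z.
  apply: (dual_family_span yT) => -[y' [T' yT']]; have := maxm m.+1.
  by rewrite ltnn; apply/not_implyP; split=> //; apply/asboolP; exists y', T'.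
have [Top Tdual] := yT.
have [k Tk1] : exists k, T k 1 != 0.
  apply/existsP; rewrite -[[exists _, _]]negbK negb_exists; apply/negP.
  move=> /forallP T0; have [_ one] := spanT 1; have := oner_neq0 A.
  by rewrite {1}one big1 ?eqxx // => i _; rewrite (eqP (negPn (T0 i))) mulr0.
have [u [Tuk Tku]] := divA Tk1; have [TkC _] := spanT 1.
have [r rT] := two_sidedMr u (Top k).
have TC x : central (\sum_(e <- r) e.1 * x * e.2).
  rewrite -rT; have [xC _] := spanT x.
  have uC : central u.
    move=> a; rewrite -[u * a]mulr1 -Tku mulrA -(mulrA u a) -(TkC k a) mulrA.
    by rewrite Tuk mul1r.
  by move=> a; rewrite -mulrA uC mulrA xC mulrA.
exists r; split.
  by have := rT 1; rewrite Tku => ->; apply: eq_bigr => e _; rewrite mulr1.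
move=> W B BZ a _; have [BDl BDr Bc] := BZ.
(* Expanding the second arguments in the basis [y] reduces the claim to an equality of coordinates
   in [A]. *)
have expr_sum (x : A * A -> A) (z : A * A -> A) :
    \sum_(e <- r) B (x e) (z e) =
      \sum_i B (\sum_(e <- r) x e * T i (z e)) (y i).
  under [RHS]eq_bigr do rewrite (balanced_suml BZ).
  rewrite exchange_big; apply: eq_bigr => e _ /=; have [zC zE] := spanT (z e).
  rewrite {1}zE (balanced_sumr BZ); apply: eq_bigr => i _.
  by rewrite -(zC i (y i)) Bc.
rewrite !expr_sum; apply: eq_bigr => i _; congr (B _ _).
have [s sT] := Top i.
transitivity (\sum_(e <- s) (\sum_(d <- r) d.1 * e.1 * d.2) * a * e.2).
  under eq_bigr do rewrite sT mulr_sumr.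
  rewrite exchange_big; apply: eq_bigr => e _ /=; rewrite !mulr_suml.
  by apply: eq_bigr => d _; rewrite !mulrA.
under eq_bigr do rewrite (TC _ a) -mulrA mulr_suml mulr_sumr.
rewrite exchange_big; apply: eq_bigr => d _ /=; rewrite sT mulr_sumr.
by apply: eq_bigr => e _; rewrite !mulrA.
Qed.

End CenterSeparating.

(** * Finite extensions of a complete discretely valued field *)

Section Torsion.
Variables (F : fieldType) (D : falgType F).

Lemma linear_relation m (b : 'I_m -> D) : (\dim {:D} < m)%N ->
  exists2 a : 'I_m -> F, \sum_i a i *: b i = 0 & exists i, a i != 0.
Proof.
move=> dm; pose X := [tuple b i | i < m].
have : ~~ free X.
  rewrite /free size_tuple neq_ltn; apply/orP; left.
  by apply: leq_ltn_trans dm; apply/dimvS/subvf.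
move=> /freeP notfree; apply: contrapT => norel; apply: notfree => a a0 i.
apply/eqP; apply: contrapT => /negP ai; apply: norel; exists a; last by exists i.
rewrite -[RHS]a0; apply: eq_bigr => j _.
by rewrite (nth_map j) ?size_enum_ord // nth_ord_enum.
Qed.

Lemma oz_argmin (G : orderedZmodType) (I : finType) (P : pred I) (f : I -> G) i :
  P i -> exists2 i0, P i0 & forall j, P j -> f i0 <= f j.
Proof.
move=> Pi; suff /(_ (enum I)) [i0 Pi0 min0] : forall s : seq I,
    exists2 i0, P i0 & forall j, j \in s -> P j -> f i0 <= f j.
  by exists i0 => // j; apply: min0; rewrite mem_enum.
elim=> [|k s [i0 Pi0 min0]]; first by exists i.
have [ki0|i0k] := boolP (P k && (f k <= f i0)).
  have /andP[Pk lek] := ki0; exists k => // j.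
  rewrite inE => /predU1P[-> //|js Pj]; apply: le_trans lek _; exact: min0.
exists i0 => // j; rewrite inE => /predU1P[-> Pk|]; last exact: min0.
by move: i0k; rewrite Pk /= -oz_ltNge; apply: ltW.
Qed.

Variables (G : orderedZmodType) (v : valuation F G) (g : G) (w : valuation D G).
Hypothesis divD : GRing.field_axiom D.
Hypothesis w_ext : val_extends v w.
Hypothesis v_int : forall x, x != 0 -> exists z : int, v x = g *~ z.

(** The other terms sum to zero or to an element of value strictly above that of [t i], so they
    cannot cancel it. *)
Lemma valuation_sum_neq0 m (t : 'I_m -> D) i :
  t i != 0 -> (forall j, t j != 0 -> w (t i) <= w (t j)) ->
  (forall j, j != i -> t j != 0 -> w (t j) != w (t i)) -> \sum_j t j != 0.
Proof.
move=> ti0 timin tdiff; apply/negP; rewrite (bigD1 i) //= addr_eq0 => /eqP tE.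
have [gt0 gtB] := val_gt_zmod_closed w (w (t i)).
have gtN x : x \in val_gt w (w (t i)) -> - x \in val_gt w (w (t i)).
  by rewrite -sub0r; apply: gtB.
have : t i \in val_gt w (w (t i)).
  rewrite {1}tE; apply: (gtN _).
  apply: (big_ind (fun x : D => x \in val_gt w (w (t i)))) => [||j ji].
  - exact: gt0.
  - by move=> x y xi yi; rewrite -[y]opprK; apply/gtB/gtN.
  - rewrite inE; case: eqVneq => //= tj0.
    by rewrite lt_neqAle timin // eq_sym tdiff.
by rewrite inE (negPf ti0) ltxx.
Qed.

(** The powers of [x] up to exponent [d] are dependent over [F]. Two terms of a relation must share
    the least value, so [w x *+ k] is a multiple of [g] for some [0 < k <= d]; the factorial is a
    common multiple of all such [k]. *)
Lemma value_torsion x : x != 0 ->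
  exists z : int, w x *+ (\dim {:D})`! = g *~ z.
Proof.
move=> x0; set d := \dim _.
have xk k := valuationX w divD k x0.
have [a rel [i1 ai1]] := @linear_relation d.+1 (fun i => x ^+ i) (ltnSn _).
pose t i := a i *: x ^+ i.
have t0 i : (t i != 0) = (a i != 0).
  by rewrite scaler_eq0 negb_or; case: (xk i) => -> _; rewrite andbT.
have wt i : a i != 0 -> w (t i) = v (a i) + w x *+ i.
  move=> ai; have [xi wi] := xk i.
  rewrite /t -mulr_algl valuationM ?scaler_eq0 ?negb_or ?ai ?oner_neq0 //.
  by rewrite w_ext // wi.
have [i ai imin] :=
  oz_argmin (P := fun i => a i != 0) (fun i => w (t i)) ai1.
have [j [ji aj wij]] : exists j, [/\ j != i, a j != 0 & w (t j) = w (t i)].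
  apply: contrapT => no; suff : \sum_j t j != 0 by rewrite rel eqxx.
  apply: (@valuation_sum_neq0 _ _ i) => [|j|j ji]; rewrite ?t0 //.
    by move=> aj; apply: imin.
  by move=> aj; apply/eqP => wij; apply: no; exists j.
have {wij} wij : v (a j) + w x *+ j = v (a i) + w x *+ i.
  by rewrite -!wt.
have {imin} [k [z [k0 kd wk]]] : exists k (z : int),
    [/\ (0 < k)%N, (k <= d)%N & w x *+ k = g *~ z].
  have [zi vi] := v_int ai; have [zj vj] := v_int aj.
  have fin (p q : 'I_d.+1) (zp zq : int) : (p < q)%N ->
      g *~ zq + w x *+ q = g *~ zp + w x *+ p ->
      exists k (z : int), [/\ (0 < k)%N, (k <= d)%N & w x *+ k = g *~ z].
    move=> pq e; exists (q - p)%N, (zp - zq); split; first by rewrite subn_gt0.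
      by rewrite (leq_trans (leq_subr _ _)) // -ltnS.
    apply: (addIr (w x *+ p)); rewrite -mulrnDr subnK ?(ltnW pq) //.
    by apply: (addrI (g *~ zq)); rewrite e mulrzBr addrA [g *~ zq + _]addrC subrK.
  rewrite vi vj in wij; have [ij|ji'|/val_inj eij] := ltngtP i j.
  - exact: fin ij wij.
  - exact: fin ji' (esym wij).
  - by rewrite eij eqxx in ji.
have /dvdnP[m ->] : (k %| d`!)%N by rewrite dvdn_fact ?k0.
by exists (z * m%:Z); rewrite mulnC mulrnA wk mulrzA pmulrn.
Qed.

End Torsion.

Section ScaledValuation.
Variables (R : nzRingType) (G : orderedZmodType) (w : valuation R G) (N : nat).

Fact scale_valM x y : x != 0 -> y != 0 ->
  w (x * y) *+ N = w x *+ N + w y *+ N.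
Proof. by move=> x0 y0; rewrite valuationM // mulrnDl. Qed.

Fact scale_valD x y : x != 0 -> y != 0 -> x + y != 0 ->
  Order.min (w x *+ N) (w y *+ N) <= w (x + y) *+ N.
Proof.
move=> x0 y0 xy0; have min_le (a b : G) : Order.min a b <= a /\ Order.min a b <= b.
  rewrite /Order.min; case: ifPn => [ab|]; first by rewrite lexx ltW.
  by rewrite -oz_leNgt lexx.
have [le1 le2] := min_le (w x *+ N) (w y *+ N).
have := valuationD w x0 y0 xy0; rewrite /Order.min; case: ifP => _ /(oz_leMn N).
  exact: le_trans.
exact: le_trans.
Qed.

Definition scale_val : valuation R G := Valuation scale_valM scale_valD.

Lemma scale_val_ge0 : (0 < N)%N -> val_ge scale_val 0 =i val_ge w 0.
Proof.
move=> N0 x; rewrite !inE /= -[X in X <= _ *+ _](mul0rn _ N); congr (_ || _).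
by apply/idP/idP; [exact: oz_leMn_cancel | exact: oz_leMn].
Qed.

Lemma scale_val_gt0 : (0 < N)%N -> val_gt scale_val 0 =i val_gt w 0.
Proof.
move=> N0 x; rewrite !inE /= !oz_ltNge -[X in _ *+ _ <= X](mul0rn _ N).
congr (_ || ~~ _).
by apply/idP/idP; [exact: oz_leMn_cancel | exact: oz_leMn].
Qed.

End ScaledValuation.

(** * Residual independence and completeness of the extension *)

Section FiniteExtension.
Variables (F : fieldType) (G : orderedZmodType) (v : valuation F G) (g : G).
Variables (D : falgType F) (w : valuation D G) (N : nat) (pi : F).
Hypothesis divD : GRing.field_axiom D.
Hypothesis g_gt0 : 0 < g.
Hypothesis v_int : forall x, x != 0 -> exists z : int, v x = g *~ z.
Hypothesis w_ext : forall a, a != 0 -> w a%:A = v a *+ N.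
Hypotheses (pi_neq0 : pi != 0) (v_pi : v pi = g).
Local Notation I := (layer v g).
Local Notation J := (layer w g).
Let divF : GRing.field_axiom F := @fieldP F.

Lemma layerZ n m a x : a \in I n -> x \in J m -> a *: x \in J (N * n + m).
Proof.
move=> aI xJ; rewrite -mulr_algl layerM //; move: aI; rewrite !layerE.
have [->|a0 /= an] := eqVneq a 0; first by rewrite scale0r eqxx.
by rewrite w_ext // mulnC mulrnA oz_leMn ?orbT.
Qed.

Lemma layerZ0 m a x : a \in I 0 -> x \in J m -> a *: x \in J m.
Proof. by move=> aI xJ; have := layerZ aI xJ; rewrite muln0. Qed.

Lemma layer_pi n : pi ^+ n \in I n.
Proof.
rewrite -[X in I X]muln1; apply: layerX.
by rewrite layerE v_pi lexx orbT.
Qed.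

Lemma layer_divide n x : x \in J (N * n) -> exists2 y, y \in J 0 & x = pi ^+ n *: y.
Proof.
have [-> _|x0] := eqVneq x 0; first by exists 0; rewrite ?rpred0 ?scaler0.
have [pin0 v_pin] := valuationX v divF n pi_neq0; rewrite v_pi in v_pin.
have xE : x = pi ^+ n *: ((pi ^+ n)^-1 *: x) by rewrite scalerA mulfV // scale1r.
move=> xJ; exists ((pi ^+ n)^-1 *: x) => //.
have y0 : (pi ^+ n)^-1 *: x != 0 by rewrite scaler_eq0 negb_or invr_eq0 pin0.
move: xJ; rewrite !layerE (negPf x0) (negPf y0) /=.
rewrite {1}xE -mulr_algl valuationM //; last first.
  by rewrite scaler_eq0 negb_or pin0 oner_neq0.
rewrite w_ext // v_pin -mulrnA mulnC mulr0n.
by rewrite -{1}[g *+ _]add0r [_ + w _]addrC oz_leD2r.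
Qed.

(** For [n = 1] this is independence in the residue ring; for [n = N] it is independence in [J 0]
    modulo [pi], since [J N] is [pi] times [J 0]. *)
Definition residually_free n m (b : 'I_m -> D) :=
  forall a : 'I_m -> F, (forall i, a i \in I 0) -> \sum_i a i *: b i \in J n ->
    forall i, a i \in I 1.

Lemma residually_free_bound n m (b : 'I_m -> D) :
  residually_free n b -> (m <= \dim {:D})%N.
Proof.
move=> bfree; rewrite leqNgt; apply/negP => /linear_relation-/(_ b)[a rel [i ai]].
have [i0 ai0 imin] := oz_argmin (P := fun i => a i != 0) (fun i => v (a i)) ai.
(* Dividing the relation by a coefficient of least value makes it integral, with one coefficient
   equal to [1]. *)
have : (a i0)^-1 * a i0 \in I 1; last first.
  by rewrite mulVf // layer1E // inE oner_eq0 valuation1 ltxx.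
apply: (bfree (fun i => (a i0)^-1 * a i)) => [j|]; last first.
  under eq_bigr do rewrite -scalerA.
  by rewrite -scaler_sumr rel scaler0 rpred0.
rewrite layerE; have [->|aj] := eqVneq (a j) 0; first by rewrite mulr0 eqxx.
by rewrite valuationM ?invr_eq0 // valuationV // addrC oz_subr_ge0 imin // orbT.
Qed.

Lemma residually_spanning n (S : D -> Prop) : (n <= N)%N ->
  (forall x, S x -> x \in J 0) ->
  exists m (b : 'I_m -> D), [/\ forall i, S (b i), residually_free n b
    & forall x, S x -> exists2 a : 'I_m -> F, forall i, a i \in I 0
        & x - \sum_i a i *: b i \in J n].
Proof.
move=> nN SJ.
pose P m := `[< exists2 b : 'I_m -> D, forall i, S (b i) & residually_free n b >].
have exP : exists m, P m.
  by exists 0%N; apply/asboolP; exists (fun=> 0) => [[]|a _ _ []].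
have boundP m : P m -> (m <= \dim {:D})%N.
  by move=> /asboolP[b _ /residually_free_bound].
case: (ex_maxnP exP boundP) => m /asboolP[b bS bfree] maxm.
exists m, b; split=> // x Sx.
pose b' (i : 'I_m.+1) := oapp b x (unlift ord0 i).
have sum_b' (a : 'I_m.+1 -> F) :
    \sum_i a i *: b' i = a ord0 *: x + \sum_i a (lift ord0 i) *: b i.
  rewrite big_ord_recl /b' unlift_none /=; congr (_ + _).
  by apply: eq_bigr => i _; rewrite liftK.
have [a [aI sumJ [i ai]]] : exists a : 'I_m.+1 -> F,
    [/\ forall i, a i \in I 0, \sum_i a i *: b' i \in J n
      & exists i, a i \notin I 1].
  apply: contrapT => no; have := maxm m.+1; rewrite ltnn.
  suff -> : P m.+1 by move/(_ isT).
  apply/asboolP; exists b' => [i|a aI sumJ i].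
    by rewrite /b'; case: unliftP => [k _|_] //=; exact: bS.
  by apply: contrapT => /negP ai; apply: no; exists a; split=> //; exists i.
(* Otherwise the term of [x] would lie in [J N], hence in [J n], and the remaining relation would
   contradict the independence of [b]. *)
have a0 : a ord0 \notin I 1.
  apply: contraNN ai => a0.
  case: (unliftP ord0 i) => [k|] -> //.
  apply: (bfree (fun k => a (lift ord0 k))) => //.
  have a0x : a ord0 *: x \in J n.
    by apply: layer_le (layerZ a0 (SJ x Sx)) => //; rewrite muln1 addn0.
  by rewrite -(addKr (a ord0 *: x) (\sum_i _)) addrC rpredB // -sum_b'.
have [a0nz a0V] := layer_unit divF g_gt0 v_int (aI ord0) a0.
exists (fun i => - ((a ord0)^-1 * a (lift ord0 i))) => [k|].
  by rewrite rpredN layer_mull.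
have -> : x - \sum_i - ((a ord0)^-1 * a (lift ord0 i)) *: b i =
    (a ord0)^-1 *: \sum_i a i *: b' i.
  rewrite sum_b' scalerDr scalerA mulVf // scale1r scaler_sumr -sumrN.
  by congr (_ + _); apply: eq_bigr => k _; rewrite scaleNr opprK scalerA.
exact: layerZ0.
Qed.

Hypothesis N_gt0 : (0 < N)%N.
Hypothesis v_cplt : forall u, (forall n, u n.+1 - u n \in I n) ->
  exists l, forall n, l - u n \in I n.

(** A finite family [b] spans [J 0] modulo [pi], so a [pi]-adic expansion reduces convergence in [D]
    to that of finitely many series of coefficients in [F]. *)
Lemma finite_extension_complete (u : nat -> D) :
  (forall n, u n.+1 - u n \in J n) -> exists l, forall n, l - u n \in J n.
Proof.
move=> uJ; have uC := layer_cauchy g_gt0 uJ.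
have [m [b [bJ _ bspan]]] :=
  residually_spanning (leqnn N) (fun x (h : x \in J 0) => h).
have /choice[co coP] : forall x, exists c : ('I_m -> F) * D,
    x \in J 0 -> [/\ forall i, c.1 i \in I 0, c.2 \in J 0
      & x = \sum_i c.1 i *: b i + pi *: c.2].
  move=> x; have [xJ|_] := boolP (x \in J 0); last by exists (fun=> 0, 0).
  have [a aI xa] := bspan x xJ; rewrite -(muln1 N) in xa.
  have [y yJ xy] := layer_divide xa; exists (a, y); split=> //=.
  by rewrite -[pi]expr1 -xy addrC subrK.
have /choice[x xP] : forall k, exists x, x \in J 0 /\
    u (N * k.+1)%N - u (N * k)%N = pi ^+ k *: x.
  move=> k; have [|x xJ ux] := @layer_divide k (u (N * k.+1)%N - u (N * k)%N).
    by apply: uC; rewrite leq_mul2l leqnSn orbT.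
  by exists x.
(* The remainder of each expansion is carried over and added to the next difference. *)
pose r := fix r k := if k is k'.+1 then (co (x k' + r k')).2 else 0.
have rJ k : r k \in J 0.
  elim: k => [|k IHk]; first exact: rpred0.
  by have [] := coP (x k + r k) _; rewrite ?rpredD //; case: (xP k).
have xrP k := coP _ (rpredD (proj1 (xP k)) (rJ k)).
pose p i k := \sum_(0 <= j < k) pi ^+ j * (co (x j + r j)).1 i.
have /choice[al alP] : forall i, exists l, forall n, l - p i n \in I n.
  move=> i; apply: v_cplt => n; rewrite /p big_nat_recr //= addrAC subrr add0r.
  by rewrite layer_mulr ?layer_pi //; case: (xrP n).
have uE k : u (N * k)%N = u 0%N + (\sum_i p i k *: b i + pi ^+ k *: r k).
  elim: k => [|k IHk].
    rewrite muln0 expr0 scale1r addr0 big1 ?addr0 // => i _.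
    by rewrite /p big_geq // scale0r.
  have [_ ux] := xP k; have [_ _ xrE] := xrP k.
  rewrite -[LHS](subrK (u (N * k)%N)) ux IHk addrCA; congr (_ + _).
  rewrite addrCA -scalerDr xrE scalerDr scalerA -exprSr addrA -/r; congr (_ + _).
  rewrite scaler_sumr -big_split; apply: eq_bigr => i _.
  by rewrite /p big_nat_recr //= scalerA -scalerDl.
exists (u 0%N + \sum_i al i *: b i) => n.
have nN : (n <= N * n)%N by rewrite leq_pmull.
rewrite -(subrKA (u (N * n)%N)) rpredD ?uC //; apply: layer_le nN _ => //.
rewrite uE opprD addrACA subrr add0r opprD addrA -sumrB rpredB //; last first.
  by have := layerZ (layer_pi n) (rJ n); rewrite addn0.
rewrite rpred_sum // => i _; rewrite -scalerBl.
by have := layerZ (alP i n) (bJ i); rewrite addn0.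
Qed.

End FiniteExtension.

(** * Lifting by the Wedderburn-Malcev argument *)

Section WedderburnLifting.
Variables (F : fieldType) (G : orderedZmodType) (D : falgType F).
Variables (w : valuation D G) (g : G) (A : nzRingType).
Variables (K : Type) (iota : K -> A) (sigma : K -> F).
Hypothesis divD : GRing.field_axiom D.
Hypothesis g_gt0 : 0 < g.
Hypothesis w_int : forall x, x != 0 -> exists z : int, w x = g *~ z.
Hypothesis w_cplt : forall u : nat -> D,
  (forall n, u n.+1 - u n \in layer w g n) ->
  exists l, forall n, l - u n \in layer w g n.
Hypothesis iota_central : forall a, central (iota a).
Hypothesis sepA : separating (fun x => exists a, x = iota a) (fun=> True).
Local Notation J := (layer w g).

(** Linearity is exact, so that the defect of multiplicativity can be contracted with a tensor over
    the image of [iota]. *)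
Definition approx_morphism n (s : A -> D) :=
  [/\ forall x y, s (x + y) = s x + s y,
      forall a x, s (iota a * x) = sigma a *: s x,
      forall x, s x \in J 0,
      forall x y, s (x * y) - s x * s y \in J n
    & s 1 - 1 \in J n].

Section Step.
Variables (n : nat) (s : A -> D).
Hypotheses (n_gt0 : (0 < n)%N) (s_approx : approx_morphism n s).

Let sD x y : s (x + y) = s x + s y. Proof. by case: s_approx. Qed.
Let sZ a x : s (iota a * x) = sigma a *: s x. Proof. by case: s_approx. Qed.
Let sJ x : s x \in J 0. Proof. by case: s_approx. Qed.
Let s1 : s 1 - 1 \in J n. Proof. by case: s_approx. Qed.

Let f x y := s (x * y) - s x * s y.
Let fJ x y : f x y \in J n. Proof. by case: s_approx => _ _ _ h _; apply: h. Qed.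

Let fDl x x' y : f (x + x') y = f x y + f x' y.
Proof. by rewrite /f !(mulrDl, sD) opprD addrACA. Qed.

Let fZl a x y : f (iota a * x) y = sigma a *: f x y.
Proof. by rewrite /f -mulrA !sZ -scalerAl -scalerBr. Qed.

Let fDr x y y' : f x (y + y') = f x y + f x y'.
Proof. by rewrite /f !(mulrDr, sD) opprD addrACA. Qed.

Let fZr a x y : f x (iota a * y) = sigma a *: f x y.
Proof.
by rewrite /f mulrA -(iota_central a x) -mulrA !sZ -scalerAr -scalerBr.
Qed.

(** The identity is exact, but the action through [s] is multiplicative on values of [f] only modulo
    [J (n + n)]. *)
Let cocycle x y z : s x * f y z - f (x * y) z + f x (y * z) - f x y * s z = 0.
Proof.
rewrite /f mulrBr mulrBl !mulrA !opprB.
rewrite -[_ + _ + (_ - s x * s (y * z))]addrA subrKA addrAC subrKA subrKA.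
by rewrite subrr.
Qed.

(* The defect of multiplicativity [f] is a Hochschild 2-cocycle modulo
   [J (n + n)]; contracting it with the separability idempotent exhibits it as
   the coboundary of [h]. *)
Lemma approx_morphism_step : exists2 s', approx_morphism n.+1 s'
  & forall x, s' x - s x \in J n.
Proof.
have [r [r1 rC]] := sepA.
pose h x := \sum_(e <- r) s e.1 * f e.2 x.
have hJ x : h x \in J n by rewrite rpred_sum // => e _; rewrite layer_mull.
have J2n x : x \in J (n + n) -> x \in J n.+1.
  by apply: layer_le => //; rewrite -addn1 leq_add2l.
have key x y : f x y + h (x * y) - s x * h y - h x * s y \in J n.+1.
  have h1 : h (x * y) - h x * s y =
      \sum_(e <- r) s e.1 * f (e.2 * x) y - (\sum_(e <- r) s e.1 * s e.2) * f x y.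
    rewrite /h !mulr_suml -!sumrB; apply: eq_bigr => e _.
    rewrite -!mulrA -!mulrBr; congr (_ * _).
    have := cocycle e.2 x y; move/eqP; rewrite subr_eq0 => /eqP <-.
    by rewrite opprD addrCA subrr addr0 opprB.
  have h2 : \sum_(e <- r) s e.1 * f (e.2 * x) y
      = \sum_(e <- r) s (x * e.1) * f e.2 y.
    apply: (rC D (fun a b => s a * f b y)) => //.
    split=> [a a' b|a b b'|c [t ->] a b].
    - by rewrite sD mulrDl.
    - by rewrite fDl mulrDr.
    - by rewrite -(iota_central t a) sZ fZl -scalerAl -scalerAr.
  (* Replacing [s (x * e.1)] by [s x * s e.1] costs a product of two values of [f]. *)
  have h3 : \sum_(e <- r) s (x * e.1) * f e.2 y - s x * h y \in J n.+1.
    rewrite /h mulr_sumr -sumrB rpred_sum // => e _.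
    by rewrite mulrA -mulrBl J2n // layerM // fJ.
  have h4 : 1 - \sum_(e <- r) s e.1 * s e.2 \in J n.
    rewrite -(subrKA (s 1)) rpredD //; first by rewrite -opprB rpredN.
    have s0 : s 0 = 0 by apply: (addrI (s 0)); rewrite -sD !addr0.
    rewrite -r1 (big_morph s sD s0) -sumrB rpred_sum // => e _.
    exact: fJ.
  have -> : f x y + h (x * y) - s x * h y - h x * s y =
      (1 - \sum_(e <- r) s e.1 * s e.2) * f x y +
      (\sum_(e <- r) s (x * e.1) * f e.2 y - s x * h y).
    rewrite addrAC -[_ + h _ - h x * _]addrA h1 h2 mulrBl mul1r.
    by rewrite [RHS]addrA; congr (_ - _); rewrite addrA [RHS]addrAC.
  by rewrite rpredD // J2n // layerM.
have hDl x y : h (x + y) = h x + h y.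
  by rewrite -big_split; apply: eq_bigr => e _; rewrite fDr mulrDr.
have hZ a x : h (iota a * x) = sigma a *: h x.
  by rewrite scaler_sumr; apply: eq_bigr => e _; rewrite fZr -scalerAr.
pose s' x := s x + h x.
have s'J x : s' x \in J 0.
  by rewrite rpredD //; apply: layer_le (hJ x).
have s'M x y : s' (x * y) - s' x * s' y \in J n.+1.
  have -> : s' (x * y) - s' x * s' y =
      (f x y + h (x * y) - s x * h y - h x * s y) - h x * h y.
    by rewrite /s' /f mulrDl !mulrDr !opprD !addrA [_ + h _ - _]addrAC.
  by rewrite rpredB // J2n // layerM.
exists s'; last by move=> x; rewrite /s' addrC addKr.
split=> //.
- by move=> x y; rewrite /s' sD hDl addrACA.
- by move=> a x; rewrite /s' sZ hZ scalerDr.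
(* Multiplicativity at [(1, 1)] says that [s' 1 * (s' 1 - 1)] is in [J n.+1], and [s' 1] is a unit,
   so the unit condition needs no correction of its own. *)
- have s'1 : s' 1 - 1 \in J n by rewrite /s' addrAC rpredD.
  apply: (layer_mul_cancel divD g_gt0 w_int (s'J 1)).
    apply/negP => s'1J; have : 1 \in J 1.
      by rewrite -(subKr (s' 1) 1) rpredB //; apply: layer_le s'1.
    by rewrite layer1E // inE oner_eq0 valuation1 ltxx.
  by rewrite mulrBr mulr1 -opprB rpredN; have := s'M 1 1; rewrite mulr1.
Qed.

End Step.

Lemma morphism_lifting (s0 : A -> D) : approx_morphism 1 s0 ->
  exists s : A -> D, [/\ forall x y, s (x + y) = s x + s y,
    forall x y, s (x * y) = s x * s y, s 1 = 1 & forall x, s x - s0 x \in J 1].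
Proof.
move=> s0a; pose T := {ns : nat * (A -> D) | approx_morphism ns.1.+1 ns.2}.
pose R (s t : T) := (sval t).1 = (sval s).1.+1 /\
  forall x, (sval t).2 x - (sval s).2 x \in J (sval s).1.+1.
have step (s : T) : exists t, R s t.
  have [s' s'a ss'] := approx_morphism_step (ltn0Sn _) (svalP s).
  by exists (exist _ ((sval s).1.+1, s') s'a).
have [q [q0 qR]] := dependent_choice (fun s => cid (step s)) (exist _ (0%N, s0) s0a).
pose s n := (sval (q n)).2.
have qn n : (sval (q n)).1 = n.
  by elim: n => [|n IHn]; [rewrite q0 | case: (qR n) => -> _; rewrite IHn].
have sa n : approx_morphism n.+1 (s n) by have := svalP (q n); rewrite qn.
have sS n x : s n.+1 x - s n x \in J n.+1.
  by case: (qR n) => _ /(_ x); rewrite qn.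
have /choice[l lP] : forall x, exists l, forall n, l - s n x \in J n.
  by move=> x; apply: w_cplt => n; apply: layer_le (sS n x).
have zero (x : D) : (forall n, x \in J n) -> x = 0.
  exact: layer_bigcap.
have lJ x : l x \in J 0.
  by rewrite -(subrK (s 0%N x) (l x)) rpredD ?lP //; case: (sa 0%N).
exists l; split=> [x y|x y||x].
- apply/eqP; rewrite -subr_eq0; apply/eqP/zero => n.
  have [sD _ _ _ _] := sa n.
  have -> : l (x + y) - (l x + l y) =
      (l (x + y) - s n (x + y)) - ((l x - s n x) + (l y - s n y)).
    by rewrite sD [l x - _ + _]addrACA -opprD opprB subrKA.
  by rewrite rpredB ?lP // rpredD ?lP.
- apply/eqP; rewrite -subr_eq0; apply/eqP/zero => n.
  have [_ _ sJ sM _] := sa n.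
  have -> : l (x * y) - l x * l y = (l (x * y) - s n (x * y)) +
      (s n (x * y) - s n x * s n y) - ((l x - s n x) * l y + s n x * (l y - s n y)).
    by rewrite subrKA mulrBl mulrBr subrKA opprB addrA subrK.
  apply: rpredB; apply: rpredD; rewrite ?lP //.
  - exact: layer_le (sM x y).
  - by rewrite layer_mulr ?lP.
  - by rewrite layer_mull ?lP.
- apply/eqP; rewrite -subr_eq0; apply/eqP/zero => n.
  have [_ _ _ _ s1] := sa n.
  by rewrite -(subrKA (s n 1)) rpredD ?lP //; apply: layer_le s1.
- have <- : s 0%N x = s0 x by rewrite /s q0.
  by rewrite -(subrKA (s 1%N x)) rpredD ?lP.
Qed.

End WedderburnLifting.

(** * The residue algebra *)

Section CompleteLayers.
Variables (F : fieldType) (G : orderedZmodType) (v : valuation F G) (g : G).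
Hypothesis g_gt0 : 0 < g.
Hypothesis v_int : forall x, x != 0 -> exists z : int, v x = g *~ z.
Variable pi : F.
Hypotheses (pi_neq0 : pi != 0) (v_pi : v pi = g).

Lemma val_complete_layer : val_complete v ->
  forall u, (forall n, u n.+1 - u n \in layer v g n) ->
  exists l, forall n, l - u n \in layer v g n.
Proof.
move=> cplt u uI; have uC := layer_cauchy g_gt0 uI.
have [c c0|l lP] := cplt u.
  have [z vc] := v_int c0; exists `|z|.+1%N => m n Nm Nn.
  have : u m - u n \in layer v g `|z|.+1.
    rewrite -(subrKA (u `|z|.+1%N)) rpredD ?uC // -opprB rpredN uC //.
  rewrite layerE inE; case: eqVneq => //= _; apply: lt_le_trans.
  rewrite oz_ltNge vc oz_mulrz_ge // -ltNge.
  by case: (z) => // k; rewrite ltz_nat /=.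
exists l => n; have [pin0 v_pin] := valuationX v (@fieldP F) n pi_neq0.
(* Testing against [pi ^+ n] gives values above [g *+ n]; the index [maxn N n] also serves the
   Cauchy bound. *)
have [N /(_ (maxn N n) (leq_maxl N n))] := lP _ pin0.
rewrite inE v_pin v_pi => lN.
rewrite -(subrKA (u (maxn N n))) rpredD ?uC ?leq_maxr // -opprB rpredN layerE.
by case: eqVneq lN => //= _; apply: ltW.
Qed.

Lemma natr_residue_pchar : [pchar F] =i [pchar residue_ring v] ->
  forall k, k%:R \in layer v g 1 -> k != 0%N ->
  exists2 p, p \in [pchar F] & (p %| k)%N.
Proof.
move=> eq_char k; rewrite layer1E // => kI k0.
have kbar : k%:R == 0 :> residue_ring v.
  by rewrite -(rmorph_nat (residue v)) residue_eq0 rmorph_nat.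
have [|p pF] := natf0_pchar _ kbar; first by rewrite lt0n.
by exists p; rewrite ?eq_char // (dvdn_pcharf pF).
Qed.

End CompleteLayers.

Section ResClass.
Variables (R : nzRingType) (G : orderedZmodType) (w : valuation R G).

Lemma res_classD x y : x \in val_ge w 0 -> y \in val_ge w 0 ->
  res_class w (x + y) = res_class w x + res_class w y.
Proof.
move=> xV yV; pose x' : val_ring w := Sub x xV; pose y' : val_ring w := Sub y yV.
by rewrite -[x]/(val x') -[y]/(val y') -rmorphD !res_class_val rmorphD.
Qed.

Lemma res_class0 : res_class w 0 = 0.
Proof. exact: etrans (res_class_val (0 : val_ring w)) (residue0 w). Qed.

Lemma res_class1 : res_class w 1 = 1.
Proof. exact: (res_class_val (1 : val_ring w)). Qed.

Lemma res_class_eq0 x :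
  x \in val_ge w 0 -> (res_class w x == 0) = (x \in val_gt w 0).
Proof. by move=> xV; rewrite -res_class0 res_class_eq ?subr0 // inE eqxx. Qed.

Lemma res_class_sum (I : Type) (r : seq I) (f : I -> R) :
  (forall i, f i \in val_ge w 0) ->
  res_class w (\sum_(i <- r) f i) = \sum_(i <- r) res_class w (f i).
Proof.
move=> fV; elim: r => [|i r IHr]; first by rewrite !big_nil res_class0.
by rewrite !big_cons res_classD ?IHr ?rpred_sum.
Qed.

End ResClass.

Section ResidueExtension.
Variables (F : fieldType) (G : orderedZmodType) (v : valuation F G).
Variables (D : falgType F) (w : valuation D G).
Hypothesis divD : GRing.field_axiom D.
Hypothesis w_ext : val_extends v w.
Local Notation K := (residue_ring v).
Local Notation A := (residue_ring w).
Local Notation iota := (@res_embed F G v D w).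

Lemma alg_val_ge (a : F) : a \in val_ge v 0 -> a%:A \in val_ge w 0.
Proof.
rewrite !inE; have [->|a0 /= aV] := eqVneq a 0; first by rewrite scale0r eqxx.
by rewrite w_ext // aV orbT.
Qed.

Fact res_embed_zmod_morphism : zmod_morphism iota.
Proof.
move=> x y; apply/eqP; rewrite -(addrK (iota y) (iota (x - y))); apply/eqP.
congr (_ - _); rewrite /res_embed -res_classD ?alg_val_ge ?res_liftP //.
rewrite -scalerDl -!(res_embedE w_ext) ?rpredD ?res_liftP //.
by rewrite res_classD ?res_liftP // !res_liftK subrK.
Qed.

Fact res_embed_monoid_morphism : monoid_morphism iota.
Proof.
split=> [|x y].
  have h : 1 \in val_ge v 0 by rewrite rpred1.
  by rewrite -(res_class1 v) res_embedE // scale1r res_class1.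
rewrite /res_embed -res_classM ?alg_val_ge ?res_liftP //.
rewrite -scalerAl mul1r scalerA -!(res_embedE w_ext) ?rpredM ?res_liftP //.
by rewrite res_classM ?res_liftP // !res_liftK.
Qed.

Definition res_embed_morphism : {rmorphism K -> A} :=
  HB.pack iota (GRing.isZmodMorphism.Build K A iota res_embed_zmod_morphism)
    (GRing.isMonoidMorphism.Build K A iota res_embed_monoid_morphism).

Lemma res_embed_central a : central (iota a).
Proof.
move=> x; rewrite -[x]res_liftK /res_embed -!res_classM ?alg_val_ge ?res_liftP //.
by rewrite mulr_algl mulr_algr.
Qed.

Lemma res_embed_eq0 a : iota a = 0 -> a = 0.
Proof.
by move=> a0; apply/eqP; rewrite -(fmorph_eq0 res_embed_morphism) -[_ a]/(iota a) a0.
Qed.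

Lemma residue_inverse (x : A) : x != 0 -> exists y, y * x = 1 /\ x * y = 1.
Proof.
move=> x0; exists (res_class w (res_lift x)^-1).
by rewrite residue_mulVx // residue_mulxV.
Qed.

Lemma res_classZ a x : a \in val_ge v 0 -> x \in val_ge w 0 ->
  res_class w (a *: x) = iota (res_class v a) * res_class w x.
Proof.
by move=> aV xV; rewrite res_embedE // -res_classM ?alg_val_ge // mulr_algl.
Qed.

End ResidueExtension.

(** * Finiteness and separability of the residue algebra *)

Section ResidueSeparable.
Variables (F : fieldType) (G : orderedZmodType) (v : valuation F G) (g : G).
Variables (D : falgType F) (w : valuation D G).
Hypothesis divD : GRing.field_axiom D.
Hypothesis w_ext : val_extends v w.
Hypothesis g_gt0 : 0 < g.
Hypothesis v_int : forall x, x != 0 -> exists z : int, v x = g *~ z.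
Local Notation K := (residue_ring v).
Local Notation A := (residue_ring w).
Local Notation iota := (res_embed_morphism w_ext).
Local Notation d := (\dim {:D}).
Local Notation w' := (scale_val w (d`!)).

Let d_gt0 : (0 < d`!)%N := fact_gt0 d.

Lemma scale_val_int x : x != 0 -> exists z : int, w' x = g *~ z.
Proof. exact: (value_torsion divD w_ext v_int). Qed.

Lemma scale_val_ext a : a != 0 -> w' a%:A = v a *+ d`!.
Proof. by move=> a0; rewrite /= w_ext. Qed.

Lemma scale_layer0 : layer w' g 0 =i val_ge w 0.
Proof. exact: scale_val_ge0. Qed.

Lemma scale_layer1 : layer w' g 1 =i val_gt w 0.
Proof. by move=> x; rewrite (layer1E g_gt0 scale_val_int) scale_val_gt0. Qed.

Lemma comb_val_ge m (a : 'I_m -> F) (b : 'I_m -> D) :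
  (forall i, a i \in val_ge v 0) -> (forall i, b i \in val_ge w 0) ->
  \sum_i a i *: b i \in val_ge w 0.
Proof.
move=> aV bV; rewrite rpred_sum // => i _.
by rewrite -mulr_algl rpredM ?(alg_val_ge w_ext).
Qed.

Lemma res_class_comb m (a : 'I_m -> F) (b : 'I_m -> D) :
  (forall i, a i \in val_ge v 0) -> (forall i, b i \in val_ge w 0) ->
  res_class w (\sum_i a i *: b i) =
    \sum_i iota (res_class v (a i)) * res_class w (b i).
Proof.
move=> aV bV; rewrite res_class_sum => [|i].
  by apply: eq_bigr => i _; rewrite (res_classZ w_ext).
by rewrite -mulr_algl rpredM ?(alg_val_ge w_ext).
Qed.

Definition residue_free m (y : 'I_m -> A) :=
  forall a : 'I_m -> K, \sum_i iota (a i) * y i = 0 -> forall i, a i = 0.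

Lemma residue_free_bound m (y : 'I_m -> A) : residue_free y -> (m <= d)%N.
Proof.
move=> yfree.
apply: (residually_free_bound g_gt0 v_int (w := w') (n := 1)
  (b := fun i => res_lift (y i))).
move=> a aI; rewrite scale_layer1 -res_class_eq0; last first.
  by apply: comb_val_ge => // i; exact: res_liftP.
rewrite res_class_comb //; last by move=> i; exact: res_liftP.
under eq_bigr do rewrite res_liftK.
move=> /eqP/yfree a0 i; rewrite layer1E // -res_class_eq0 ?a0 ?eqxx //.
Qed.

Lemma residue_spanning (S : A -> Prop) : exists m (y : 'I_m -> A),
  [/\ forall i, S (y i), residue_free y
    & forall x, S x -> exists a : 'I_m -> K, x = \sum_i iota (a i) * y i].
Proof.
have [|x [xV _]|m [b [bS bfree bspan]]] := residually_spanning g_gt0 v_int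
  scale_val_ext (n := 1) (S := fun x => x \in val_ge w 0 /\ S (res_class w x)).
- exact: d_gt0.
- by rewrite scale_layer0.
have bV i : b i \in val_ge w 0 by case: (bS i).
exists m, (fun i => res_class w (b i)); split=> [i|a a0 i|x Sx].
- by case: (bS i).
- apply/eqP; rewrite -[a i]res_liftK res_class_eq0 ?res_liftP //.
  rewrite -(layer1E g_gt0 v_int).
  apply: (bfree (fun i => res_lift (a i))) => [j|]; first exact: res_liftP.
  rewrite scale_layer1 -res_class_eq0.
    rewrite res_class_comb // => [|j]; last exact: res_liftP.
    by under eq_bigr do rewrite res_liftK; rewrite a0.
  by apply: comb_val_ge => // j; exact: res_liftP.
- have [|a aI xa] := bspan (res_lift x); first by rewrite res_liftK res_liftP.
  exists (fun i => res_class v (a i)); rewrite -res_class_comb // -[LHS]res_liftK.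
  apply/eqP; rewrite res_class_eq ?res_liftP -?scale_layer1 //.
  exact: comb_val_ge.
Qed.

(** Applying [T i] to a relation over the residue field isolates its [i]-th coefficient, so a dual
    family is free and its length is bounded. *)
Lemma dual_family_bound m (y : 'I_m -> A) T : dual_family y T -> (m <= d)%N.
Proof.
move=> [Top Tdual]; apply: (residue_free_bound (y := y)) => a rel i.
apply: (res_embed_eq0 w_ext).
have := two_sided_linear y (Top i) (fun j => res_embed_central w_ext (a j)).
rewrite -[X in T i X]/(\sum_j iota (a j) * y j) rel (bigD1 i) //= Tdual eqxx mulr1.
rewrite big1 => [|j ji]; last by rewrite Tdual eq_sym (negPf ji) mulr0.
rewrite addr0 => <-; case: (Top i) => r ->; rewrite big1 // => e _.
by rewrite mulr0 mul0r.
Qed.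

Section Root.
Variable alpha : A.
Hypothesis alpha_central : central alpha.

Lemma comm_res_embed : commr_rmorph iota alpha.
Proof. by move=> a; apply: alpha_central. Qed.
Local Notation ev := (horner_morph comm_res_embed).

Lemma horner_morph_sum (p : {poly K}) :
  ev p = \sum_(0 <= j < size p) iota p`_j * alpha ^+ j.
Proof.
by rewrite /horner_morph horner_coef size_map_poly big_mkord; apply: eq_bigr => i _;
  rewrite coef_map.
Qed.

Lemma horner_morph_deriv (p : {poly K}) :
  ev p^`() = \sum_(0 <= j < size p) (iota p`_j * alpha ^+ j.-1) *+ j.
Proof.
rewrite /horner_morph (@horner_coef_wide _ (size p).-1); last first.
  by rewrite size_map_poly size_poly.
have [->|p0] := eqVneq p 0; first by rewrite size_poly0 big_ord0 big_geq.
have /prednK <- : (0 < size p)%N by rewrite size_poly_gt0.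
rewrite big_nat_recl // mulr0n add0r big_mkord; apply: eq_bigr => i _.
by rewrite coef_map coef_deriv raddfMn mulrnAl.
Qed.

Lemma horner_morph_central p : central (ev p).
Proof.
move=> x; rewrite horner_morph_sum mulr_suml mulr_sumr; apply: eq_bigr => i _.
have aC : GRing.comm x (alpha ^+ i).
  by apply: commrX; rewrite /GRing.comm alpha_central.
by rewrite -mulrA -aC mulrA (res_embed_central w_ext) mulrA.
Qed.

(** For a nonzero annihilator of least size, the derivative is shorter, and in characteristic 0 it
    is nonzero, so it cannot annihilate [alpha]. *)
Lemma annihilator_pchar0 : [pchar K] =i pred0 ->
  exists p, ev p = 0 /\ ev p^`() != 0.
Proof.
move=> /pcharf0P char0.
have [p0 [p0nz evp0]] : exists p, p != 0 /\ ev p = 0.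
  apply: contrapT => no.
  suff : (d.+1 <= d)%N by rewrite ltnn.
  apply: (@residue_free_bound _ (fun i : 'I_d.+1 => alpha ^+ i)) => a rel i.
  apply: contrapT => /eqP ai; apply: no; exists (\poly_(j < d.+1) a (inord j)).
  split.
    apply: contraNneq ai => /(congr1 (fun p : {poly K} => p`_i)).
    by rewrite coef_poly ltn_ord inord_val coef0 => ->.
  rewrite /horner_morph (@horner_coef_wide _ d.+1); last first.
    by rewrite size_map_poly size_poly.
  rewrite -[RHS]rel; apply: eq_bigr => j _.
  by rewrite coef_map coef_poly ltn_ord inord_val.
have exn : exists n, `[< exists p, [/\ p != 0, ev p = 0 & size p = n] >].
  by exists (size p0); apply/asboolP; exists p0.
case: (ex_minnP exn) => n /asboolP[p [pnz evp sp]] minn; exists p; split=> //.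
apply/negP => /eqP evp'.
have p'0 : p^`() = 0.
  apply/eqP/negPn/negP => p'nz; have := minn (size p^`()).
  rewrite leqNgt -sp lt_size_deriv // => h.
  suff : false by []; apply: h; apply/asboolP; exists p^`(); by split.
have [n1|n1] := leqP n 1.
  have := evp; rewrite [p]size1_polyC ?sp // /horner_morph map_polyC hornerC /=.
  move=> /(res_embed_eq0 w_ext) c0; move: pnz.
  by rewrite [p]size1_polyC ?sp // c0 polyC0 eqxx.
have [k nk] : exists k, n = k.+2 by case: (n) n1 => [|[|k]] // _; exists k.
have := congr1 (fun q : {poly K} => q`_k) p'0.
rewrite coef_deriv coef0 -mulr_natr => /eqP; rewrite mulf_eq0 char0 orbF.
have -> : p`_k.+1 = lead_coef p by rewrite lead_coefE sp nk.
by rewrite lead_coef_eq0 (negPf pnz).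
Qed.

Lemma annihilator_separable (p : {poly K}) : separable_poly p -> ev p = 0 ->
  ev p^`() != 0.
Proof.
rewrite unlock => /Bezout_eq1_coprimepP[[q r] /= qr] evp; apply/negP => /eqP evp'.
have := congr1 ev qr; rewrite rmorphD !rmorphM rmorph1 /= evp evp' !mulr0 addr0.
by move/esym/eqP; rewrite oner_eq0.
Qed.

End Root.

Hypothesis center_separable : forall (z : A) (zC : central z),
  exists p, horner_morph (comm_res_embed zC) p = 0 /\
    horner_morph (comm_res_embed zC) p^`() != 0.

(** A finite family [y] spans the center over the residue field. A map balanced over the scalars and
    over [y] is balanced over the whole center, which lets the two stages be composed. *)
Lemma separating_residue : separating (fun x => exists a, x = iota a) (fun=> True).
Proof.
have [m [y [yC _ yspan]]] := residue_spanning (@central A).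
pose S x := (exists a, x = iota a) \/ x \in codom y.
have sepS : separating (fun x => exists a, x = iota a) S.
  apply: separating_seq => [_ [a ->]|_ /codomP[i ->]].
    exact: (res_embed_central w_ext).
  split=> //; have [p [evp evp']] := center_separable (yC i).
  have [u [uev evu]] := residue_inverse divD evp'.
  have evC := horner_morph_central (yC i) p^`().
  exists u, (size p), (fun j => iota p`_j); split.
  - move=> x; set t := horner_morph _ _ in uev evu evC.
    by rewrite -[u * x]mulr1 -evu mulrA -(mulrA u x) -(evC x) mulrA uev mul1r.
  - by move=> j; exists p`_j.
  - by rewrite -horner_morph_sum.
  - by rewrite -horner_morph_deriv.
have sepC : separating (@central A) (fun=> True).
  apply: (separating_center (residue_inverse divD) (n := d)) => k z T.
  exact: dual_family_bound.
apply: (separating_tower sepS); apply: (separating_base sepC) => W B BS.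
have [BDl BDr BC] := BS; split=> // z zC s t.
have [a ->] := yspan z zC.
rewrite mulr_sumr mulr_suml (balanced_suml BS) (balanced_sumr BS).
apply: eq_bigr => i _; rewrite mulrA BC; last by right; apply: codom_f.
by rewrite BC ?mulrA //; left; exists (a i).
Qed.

End ResidueSeparable.

(** * The initial linear section *)

Section Coordinates.
Variables (F : fieldType) (G : orderedZmodType) (v : valuation F G) (g : G).
Variables (D : falgType F) (w : valuation D G).
Hypothesis divD : GRing.field_axiom D.
Hypothesis w_ext : val_extends v w.
Hypothesis g_gt0 : 0 < g.
Hypothesis v_int : forall x, x != 0 -> exists z : int, v x = g *~ z.
Variable L : subringClosed F.
Hypothesis L_integral : {subset L <= val_ge v 0}.
Hypothesis L_reduced : forall x, x \in L -> x \in val_gt v 0 -> x = 0.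
Hypothesis L_surj : surjects v g L.
Local Notation K := (residue_ring v).
Local Notation A := (residue_ring w).
Local Notation iota := (res_embed_morphism w_ext).
Local Notation d := (\dim {:D}).
Local Notation w' := (scale_val w (d`!)).

(** A residue has only one representative in [L], so the choice of representatives respects sums and
    products. *)
Lemma residue_section : exists sigma : K -> F,
  [/\ forall a, sigma a \in L, forall a, res_class v (sigma a) = a,
      forall a b, sigma (a + b) = sigma a + sigma b
    & forall a b, sigma (a * b) = sigma a * sigma b].
Proof.
have /choice[sigma sP] : forall a : K, exists x, x \in L /\ res_class v x = a.
  move=> a; have [x xL ax] := L_surj (res_liftP a).
  exists x; split=> //; rewrite -[RHS]res_liftK; apply/esym/eqP.
  by rewrite res_class_eq ?res_liftP ?L_integral // -(layer1E g_gt0 v_int).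
have sL a : sigma a \in L by case: (sP a).
have sV a : sigma a \in val_ge v 0 by apply: L_integral.
have sK a : res_class v (sigma a) = a by case: (sP a).
have inj x y : x \in L -> y \in L -> res_class v x = res_class v y -> x = y.
  move=> xL yL /eqP; rewrite res_class_eq ?L_integral // => xy.
  by apply/eqP; rewrite -subr_eq0; apply/eqP/L_reduced => //; rewrite rpredB.
exists sigma; split=> // a b; apply: inj; rewrite ?rpredD ?rpredM //.
  by rewrite res_classD // !sK.
by rewrite res_classM // !sK.
Qed.

(** Lifting a basis of the residue algebra gives exact linearity, by uniqueness of coordinates;
    products and the unit are respected modulo layer 1. *)
Lemma linear_section : exists (sigma : K -> F) (s0 : A -> D),
  (forall x, res_class w (s0 x) = x) /\ approx_morphism w' g iota sigma 1 s0.
Proof.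
have [sigma [sL sK sD sM]] := residue_section; exists sigma.
have sV a : sigma a \in val_ge v 0 by apply: L_integral.
have [m [y [_ yfree yspan]]] := residue_spanning divD w_ext g_gt0 v_int (fun=> True).
have /choice[c cP] := fun x => yspan x I.
have c_unique x (a : 'I_m -> K) :
    x = \sum_i iota (a i) * y i -> forall i, c x i = a i.
  move=> xa i; apply/eqP; rewrite -subr_eq0; apply/eqP; move: i.
  apply: (yfree (fun i => c x i - a i)).
  under eq_bigr do rewrite rmorphB mulrBl.
  by rewrite sumrB -cP -xa subrr.
pose s0 x := \sum_i sigma (c x i) *: res_lift (y i).
have s0V x : s0 x \in val_ge w 0.
  by apply: (comb_val_ge w_ext) => // i; exact: res_liftP.
have s0K x : res_class w (s0 x) = x.
  rewrite (res_class_comb w_ext) // => [|i]; last exact: res_liftP.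
  by rewrite [RHS]cP; apply: eq_bigr => i _; rewrite sK res_liftK.
have s0_1 x y' : x \in val_ge w 0 -> y' \in val_ge w 0 ->
    res_class w x = res_class w y' -> x - y' \in layer w' g 1.
  move=> xV yV /eqP.
  by rewrite res_class_eq // (scale_layer1 divD w_ext g_gt0 v_int).
exists s0; split=> //; split=> [x x'|a x|x|x x'|].
- rewrite -big_split; apply: eq_bigr => i _ /=; rewrite -scalerDl -sD.
  congr (sigma _ *: _); apply: (c_unique _ (fun i => c x i + c x' i)).
  under eq_bigr do rewrite rmorphD mulrDl.
  by rewrite big_split /= -!cP.
- rewrite scaler_sumr; apply: eq_bigr => i _; rewrite scalerA -sM.
  congr (sigma _ *: _); apply: (c_unique _ (fun i => a * c x i)).
  under eq_bigr do rewrite rmorphM -mulrA.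
  by rewrite -mulr_sumr -cP.
- by rewrite scale_layer0.
- by apply: s0_1; rewrite ?rpredM // res_classM // !s0K.
- by apply: s0_1; rewrite ?rpred1 // s0K res_class1.
Qed.

End Coordinates.

Lemma tame_center_root (F : fieldType) (G : orderedZmodType) (v : valuation F G)
    (D : falgType F) (w : valuation D G) (divD : GRing.field_axiom D)
    (w_ext : val_extends v w) g (g_gt0 : 0 < g)
    (v_int : forall x, x != 0 -> exists z : int, v x = g *~ z) :
  tame v w -> forall (z : residue_ring w) (zC : central z),
  exists p, horner_morph (comm_res_embed w_ext zC) p = 0 /\
    horner_morph (comm_res_embed w_ext zC) p^`() != 0.
Proof.
move=> [char0|[q _ [_ sep _]]] z zC.
  exact: (annihilator_pchar0 divD w_ext g_gt0 v_int zC char0).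
have [p psep pz] := sep z zC; exists p.
have evp : horner_morph (comm_res_embed w_ext zC) p = 0 by apply/eqP: pz.
by split=> //; apply: annihilator_separable.
Qed.

Theorem theorem1 (F : fieldType) (G : orderedZmodType) (v : valuation F G)
    (D : falgType F) (w : valuation D G)
    (v_discrete : discrete_rank1 v) (v_complete : val_complete v)
    (eq_char : [pchar F] =i [pchar (residue_ring v)])
    (D_division : GRing.field_axiom D) (D_central : 'Z({:D})%VS = 1%VS)
    (w_ext : val_extends v w) (D_tame : tame v w) :
  exists s : {rmorphism residue_ring w -> val_ring w}, cancel s (residue w).
Proof.
have [g g_gt0 gE] := v_discrete.
have v_int x : x != 0 -> exists z : int, v x = g *~ z.
  move=> x0; have : value_group v (v x) by exists x.
  by rewrite gE => -[z _ <-]; exists z.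
have [pi pi0 v_pi] : exists2 pi, pi != 0 & v pi = g.
  have : value_group v g by rewrite gE; exists 1.
  by case=> pi /= pi0 <-; exists pi.
have v_cplt := val_complete_layer g_gt0 v_int pi0 v_pi v_complete.
have [L [L_int L_red L_surj]] :=
  coefficient_field g_gt0 v_int (natr_residue_pchar g_gt0 v_int eq_char) v_cplt.
have {}L_red x : x \in L -> x \in val_gt v 0 -> x = 0.
  by move=> xL; rewrite -(layer1E g_gt0 v_int); apply: L_red.
have [sigma [s0 [s0K s0_approx]]] :=
  linear_section D_division w_ext g_gt0 v_int L_int L_red L_surj.
have w'_int := scale_val_int D_division w_ext v_int.
have w'_ext := scale_val_ext w_ext.
have w'_cplt := finite_extension_complete g_gt0 v_int w'_ext pi0 v_pi
  (fact_gt0 _) v_cplt.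
have sep := separating_residue D_division g_gt0 v_int
  (tame_center_root D_division w_ext g_gt0 v_int D_tame).
have [s [sD sM s1 ss0]] := morphism_lifting D_division g_gt0 w'_int w'_cplt
  (res_embed_central w_ext) sep s0_approx.
have s0V x : s0 x \in val_ge w 0.
  by rewrite -(scale_layer0 g); case: s0_approx.
(* Agreement of [s] with [s0] modulo layer 1 keeps its values integral, and later makes it a
   section. *)
have sV x : s x \in val_ge w 0.
  rewrite -(scale_layer0 g) -(subrK (s0 x) (s x)) rpredD ?scale_layer0 //.
  by rewrite -(scale_layer0 g); apply: layer_le (ss0 x).
pose S x : val_ring w := Sub (s x) (sV x).
have S_zmod : zmod_morphism S.
  move=> x y; apply: val_inj; rewrite rmorphB /=.
  by apply: (addIr (s y)); rewrite subrK -sD subrK.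
have S_monoid : monoid_morphism S.
  by split=> [|x y]; apply: val_inj; rewrite ?rmorph1 ?rmorphM /=.
pose SM : {rmorphism residue_ring w -> val_ring w} :=
  HB.pack S (GRing.isZmodMorphism.Build _ _ S S_zmod)
    (GRing.isMonoidMorphism.Build _ _ S S_monoid).
exists SM => x; rewrite -res_class_val -[RHS]s0K /=; apply/eqP.
by rewrite res_class_eq // -(scale_layer1 D_division w_ext g_gt0 v_int).
Qed.
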